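(* Let $(M_j,g_j)$, $j=1,2$, be two open, $C^\infty$-smooth, globally hyperbolic, time-oriented Lorentzian manifolds of dimension $n\ge 3$, let $\hat\mu_j:[-1,1]\to M_j$ be smooth future-pointing time-like paths, and let $p_j^\pm=\hat\mu_j(s_\pm)$, where $-1<s_-<s_+<1$. Let $V_j\subset M_j$ be open connected neighborhoods of $\hat\mu_j([-1,1])$, and let $W_j\subset M_j$ be relatively compact open sets such that $\overline{W_j}\subset J^-(p_j^+)\setminus I^-(p_j^-)$. Assume that there is a conformal diffeomorphism $\Phi:V_1\to V_2$ such that $\Phi(\hat\mu_1(s))=\hat\mu_2(s)$ for all $s\in[-1,1]$ and $\{\Phi(S);\ S\in\mathcal E_{V_1}(W_1)\}=\mathcal E_{V_2}(W_2)$. Let $\Psi:W_1\to W_2$ be a diffeomorphism such that $\Psi^*g_2$ is conformal to $g_1$ and $\Psi|_{W_1\cap V_1}=\Phi|_{W_1\cap V_1}$. Assume moreover that $(W_j,g_j|_{W_j})$, $j=1,2$, are Ricci-flat, that $\Phi:V_1\to V_2$ is an isometry, and that every connected component of $W_j$ intersects $V_j$, $j=1,2$. Then $\Psi$ is an isometry.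
   Context: Signature is $(-,+,\dots,+)$. A smooth path $\mu$ is time-like if $g(\dot\mu,\dot\mu)<0$ everywhere and causal if $g(\dot\mu,\dot\mu)\le0$ and $\dot\mu\ne0$ everywhere. $p\ll q$ means $p\neq q$ and there is a future-pointing time-like path from $p$ to $q$; $p\le q$ means $p=q$ or there is a future-pointing causal path from $p$ to $q$. $I^+(p)=\{q:\ p\ll q\}$, $J^+(p)=\{q:\ p\le q\}$, and $I^-(p),J^-(p)$ are the corresponding pasts. $(M,g)$ is globally hyperbolic if it has no closed causal paths and all sets $J^+(q_1)\cap J^-(q_2)$ are compact. $L_q^+M$ is the set of non-zero future-pointing light-like vectors in $T_qM$, $\gamma_{q,\xi}(t)=\exp_q(t\xi)$, and $\mathcal L^+(q)=\{\gamma_{q,\xi}(t);\ \xi\in L_q^+M,\ t\ge0\}$. For open $V\subset M$, $\mathcal P_V(q)=\mathcal L^+(q)\cap V$ and $\mathcal E_V(q)$ is the set of those $x\in\mathcal P_V(q)$ for which there are no $y\in\mathcal P_V(q)$ and future-pointing time-like path $\alpha:[0,1]\to V$ with $\alpha(0)=y$, $\alpha(1)=x$. $\mathcal E_V(W)=\{\mathcal E_V(q);\ q\in W\}$ (an unindexed set of subsets of $V$). A map $\Psi:(V_1,g_1)\to(V_2,g_2)$ is a conformal diffeomorphism if it is a diffeomorphism and $g_1=e^{2f}\Psi^*g_2$ for some smooth scalar function $f$. *)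

(* Defs.v *)
From HB Require Import structures.
From mathcomp Require Import all_boot all_order all_algebra.
From mathcomp Require Import all_classical all_reals all_analysis.
Set Implicit Arguments.
Unset Strict Implicit.
Unset Printing Implicit Defensive.
Import Order.TTheory GRing.Theory Num.Theory.
Import numFieldNormedType.Exports.
Local Open Scope classical_set_scope.
Local Open Scope ring_scope.

(* [Ck_on k U f] is meant for open U and finite-dimensional V: there x |-> 'd f x
   is C^k if and only if x |-> 'd f x v is C^k for every v. *)
Fixpoint Ck_on (R : realType) (V W : normedModType R) (k : nat) (U : set V)
    (f : V -> W) : Prop :=
  match k with
  | 0%N => forall x, U x -> {for x, continuous f}
  | k'.+1 => (forall x, U x -> differentiable f x) /\
             (forall v, Ck_on k' U (fun x => 'd f x v))
  end.

Definition smooth_on (R : realType) (V W : normedModType R) (U : set V)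
    (f : V -> W) : Prop :=
  forall k, Ck_on k U f.

(* [cinv] is only meaningful on the image of [cdom]. *)
Record chart (R : realType) (n : nat) (T : topologicalType) := Chart {
  cdom : set T;
  cmap :> T -> 'rV[R]_n;
  cinv : 'rV[R]_n -> T;
  cdom_open : open cdom;
  cimg_open : open (cmap @` cdom);
  cmapK : forall p, cdom p -> cinv (cmap p) = p;
  cmap_continuous : forall p, cdom p -> {for p, continuous cmap};
  cinv_continuous : forall y, (cmap @` cdom) y -> {for y, continuous cinv}
}.

(* The atlas need not be maximal. [chart_at p] is a preferred chart around p:
   its only role is to give a concrete model of the tangent space T_pM. *)
Record manifold (R : realType) (n : nat) := Manifold {
  mcarrier :> topologicalType;
  mhausdorff : hausdorff_space mcarrier;
  msecond_countable : @second_countable mcarrier;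
  atlas : set (chart R n mcarrier);
  chart_at : mcarrier -> chart R n mcarrier;
  chart_at_atlas : forall p, atlas (chart_at p);
  chart_at_dom : forall p, cdom (chart_at p) p;
  atlas_compatible : forall c d, atlas c -> atlas d ->
    smooth_on (c @` (cdom c `&` cdom d)) (d \o cinv c)
}.

(* T_pM: a vector is given by its components in the chart [chart_at p]. *)
Definition tangent (R : realType) (n : nat) (M : manifold R n) (p : M) : Type :=
  'rV[R]_n.

Section Manifolds.
Context {R : realType} {n : nat}.
Implicit Types M N : manifold R n.

Definition to_chart M (c : chart R n M) (p : M) (v : tangent p) : 'rV[R]_n :=
  'd (c \o cinv (chart_at p)) (chart_at p p) v.
Arguments to_chart {M} c p v.

Definition of_chart M (c : chart R n M) (p : M) (w : 'rV[R]_n) : tangent p :=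
  'd (chart_at p \o cinv c) (c p) w.

Definition smooth_function M (U : set M) (f : M -> R) : Prop :=
  forall c, atlas c -> smooth_on (c @` (cdom c `&` U)) (f \o cinv c : _ -> R^o).

Definition smooth_map M N (U : set M) (F : M -> N) : Prop :=
  (forall p, U p -> {for p, continuous F}) /\
  forall c d, atlas c -> atlas d ->
    smooth_on (c @` (cdom c `&` U `&` F @^-1` (cdom d))) (d \o F \o cinv c).

Definition smooth_vector_field M (X : forall p : M, tangent p) : Prop :=
  forall c, atlas c ->
    smooth_on (c @` cdom c) (fun y => to_chart c (cinv c y) (X (cinv c y))).

Definition tangent_map M N (F : M -> N) (p : M) (v : tangent p) : tangent (F p) :=
  'd (chart_at (F p) \o F \o cinv (chart_at p)) (chart_at p p) v.

Definition diffeomorphism M N (U : set M) (V : set N) (F : M -> N) : Prop :=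
  smooth_map U F /\
  exists G : N -> M,
    [/\ smooth_map V G,
        forall p, U p -> V (F p) /\ G (F p) = p &
        forall q, V q -> U (G q) /\ F (G q) = q].

Definition smooth_curve M (I : set R) (mu : R -> M) : Prop :=
  (forall t, I t -> {for t, continuous mu}) /\
  forall c, atlas c ->
    smooth_on (I `&` mu @^-1` (cdom c) : set R^o) (c \o mu : R^o -> _).

(* A smooth path on the closed interval [a, b] is the restriction to [a, b] of
   a smooth curve on an open interval; the values of mu outside [a, b] play no
   other role. *)
Definition smooth_path M (a b : R) (mu : R -> M) : Prop :=
  exists2 e, 0 < e & smooth_curve `]a - e, b + e[ mu.

Definition velocity M (mu : R -> M) (t : R) : tangent (mu t) :=
  derive1 (chart_at (mu t) \o mu) t.

Definition minkowski_form : 'M[R]_n :=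
  diag_mx (\row_i (if i == 0%N :> nat then -1 else 1)).

Definition lorentz_signature (A : 'M[R]_n) : Prop :=
  exists2 P, P \in unitmx & A = P *m minkowski_form *m P^T.

(* The components g_ij = g(d/dx^i, d/dx^j) in the chart c, as functions of the
   coordinates. *)
Definition metric_coord M (g : forall p : M, 'M[R]_n) (c : chart R n M)
    (y : 'rV[R]_n) : 'M[R]_n :=
  \matrix_(i, j)
    (of_chart c (cinv c y) (delta_mx 0 i) *m g (cinv c y) *m
       (of_chart c (cinv c y) (delta_mx 0 j))^T) 0 0.

End Manifolds.

Arguments to_chart {R n M} c p v.
Arguments tangent_map {R n M N} F p v.

(* [metric p] is the Gram matrix of g on T_pM. The time orientation is given by
   a smooth time-like vector field, declared to be future-pointing. *)
Record spacetime (R : realType) (n : nat) := Spacetime {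
  smanifold :> manifold R n;
  metric : smanifold -> 'M[R]_n;
  metric_lorentz : forall p, lorentz_signature (metric p);
  metric_smooth : forall c i j, atlas c ->
    smooth_on (c @` cdom c) (fun y => metric_coord metric c y i j : R^o);
  torient : forall p : smanifold, tangent p;
  torient_smooth : smooth_vector_field torient;
  torient_timelike : forall p, (torient p *m metric p *m (torient p)^T) 0 0 < 0
}.

Section Spacetimes.
Context {R : realType} {n : nat}.
Implicit Type M : spacetime R n.

Definition gdot M (p : M) (u v : tangent p) : R := (u *m metric p *m v^T) 0 0.
Arguments gdot {M} p u v.

Definition future_pointing M (p : M) (v : tangent p) : Prop :=
  gdot p v (torient p) < 0.
Arguments future_pointing {M} p v.

Definition causal_path M (a b : R) (mu : R -> M) : Prop :=
  smooth_path a b mu /\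
  forall t, a <= t <= b ->
    gdot (mu t) (velocity mu t) (velocity mu t) <= 0 /\ velocity mu t <> 0.

Definition timelike_path M (a b : R) (mu : R -> M) : Prop :=
  smooth_path a b mu /\
  forall t, a <= t <= b -> gdot (mu t) (velocity mu t) (velocity mu t) < 0.

Definition future_path M (a b : R) (mu : R -> M) : Prop :=
  forall t, a <= t <= b -> future_pointing (mu t) (velocity mu t).

Definition chron M (p q : M) : Prop :=
  p <> q /\
  exists a b mu, [/\ a < b, timelike_path a b mu, future_path a b mu,
                     mu a = p & mu b = q].

Definition causal M (p q : M) : Prop :=
  p = q \/
  exists a b mu, [/\ a < b, causal_path a b mu, future_path a b mu,
                     mu a = p & mu b = q].

Definition Ifuture M (p : M) : set M := [set q | chron p q].
Definition Ipast M (p : M) : set M := [set q | chron q p].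
Definition Jfuture M (p : M) : set M := [set q | causal p q].
Definition Jpast M (p : M) : set M := [set q | causal q p].

Definition globally_hyperbolic M : Prop :=
  (forall a b (mu : R -> M), a < b -> causal_path a b mu -> mu a <> mu b) /\
  (forall q1 q2 : M, compact (Jfuture q1 `&` Jpast q2)).

Definition partial (i : 'I_n) (f : 'rV[R]_n -> R) (y : 'rV[R]_n) : R :=
  'D_(delta_mx 0 i) (f : _ -> R^o) y.

Definition christoffel M (c : chart R n M) (k i j : 'I_n) (y : 'rV[R]_n) : R :=
  let g := metric_coord (@metric _ _ M) c in
  2^-1 * \sum_l invmx (g y) k l *
    (partial i (fun z => g z j l) y + partial j (fun z => g z i l) y
     - partial l (fun z => g z i j) y).

(* R^k_{l i j}, with R(X, Y) Z = [nabla_X, nabla_Y] Z - nabla_[X, Y] Z and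
   R(d_i, d_j) d_l = R^k_{l i j} d_k. *)
Definition riemann M (c : chart R n M) (k l i j : 'I_n) (y : 'rV[R]_n) : R :=
  partial i (christoffel c k j l) y - partial j (christoffel c k i l) y
  + \sum_m (christoffel c k i m y * christoffel c m j l y
            - christoffel c k j m y * christoffel c m i l y).

Definition ricci M (c : chart R n M) (l j : 'I_n) (y : 'rV[R]_n) : R :=
  \sum_k riemann c k l k j y.

Definition ricci_flat M (W : set M) : Prop :=
  forall c p, atlas c -> cdom c p -> W p -> forall i j, ricci c i j (c p) = 0.

Definition geodesic M (a b : R) (gam : R -> M) : Prop :=
  smooth_path a b gam /\
  forall t c, a <= t <= b -> atlas c -> cdom c (gam t) -> forall k : 'I_n,
    derive1n 2 (fun s => c (gam s) 0 k : R^o) t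
    + \sum_i \sum_j christoffel c k i j (c (gam t)) *
        derive1 (fun s => c (gam s) 0 i : R^o) t *
        derive1 (fun s => c (gam s) 0 j : R^o) t = 0.

(* [exp_at q v x]: exp_q(v) is defined and equal to x. *)
Definition exp_at M (q : M) (v : tangent q) (x : M) : Prop :=
  exists gam, [/\ geodesic 0 1 gam, gam 0 = q,
    velocity gam 0 = v :> 'rV[R]_n & gam 1 = x].
Arguments exp_at {M} q v x.

Definition future_lightlike M (q : M) : set (tangent q) :=
  [set xi : 'rV[R]_n | [/\ xi <> 0, gdot q xi xi = 0 & future_pointing q xi]].
Arguments future_lightlike {M} q.

Definition light_cone M (q : M) : set M :=
  [set x | exists (xi : 'rV[R]_n) t,
     [/\ future_lightlike q xi, 0 <= t & exp_at q (t *: xi) x]].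

Definition light_obs M (V : set M) (q : M) : set M := light_cone q `&` V.

Definition earliest_obs M (V : set M) (q : M) : set M :=
  [set x | light_obs V q x /\
     ~ exists y al, [/\ light_obs V q y, timelike_path 0 1 al,
         future_path 0 1 al, forall t, 0 <= t <= 1 -> V (al t) &
         al 0 = y /\ al 1 = x]].

Definition earliest_obs_family M (V W : set M) : set (set M) :=
  [set earliest_obs V q | q in W].

Definition conformal_diffeo (M1 M2 : spacetime R n) (U1 : set M1) (U2 : set M2)
    (F : M1 -> M2) : Prop :=
  diffeomorphism U1 U2 F /\
  exists2 f : M1 -> R, smooth_function U1 f &
    forall p (u v : tangent p), U1 p ->
      gdot p u v =
        expR (2 * f p) * gdot (F p) (tangent_map F p u) (tangent_map F p v).

Definition lorentz_isometry (M1 M2 : spacetime R n) (U1 : set M1) (U2 : set M2)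
    (F : M1 -> M2) : Prop :=
  diffeomorphism U1 U2 F /\
  forall p (u v : tangent p), U1 p ->
    gdot p u v = gdot (F p) (tangent_map F p u) (tangent_map F p v).

(* Charts take values in R^n, so there is no boundary; what remains of "open
   manifold" is non-compactness. *)
Definition open_manifold M : Prop := ~ compact [set: M].

End Spacetimes.

Arguments gdot {R n M} p u v.
Arguments future_pointing {R n M} p v.
Arguments exp_at {R n M} q v x.
Arguments future_lightlike {R n M} q.

(* Main.v *)
(* Write g1 = e^{2f} Psi^* g2 on W1, theta = df and w = grad f. If both metrics are Ricci-flat
   and n >= 3, the conformal transformation law of the Ricci tensor together with its trace
   determines the whole Hessian of f in terms of df:
     Hess f = - df (x) df + 1/2 |df|^2 g1.
   In a chart this is a homogeneous linear system for df with locally bounded coefficients, so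
   by Gronwall's inequality along segments f vanishes near a point as soon as f and df vanish
   somewhere nearby. Hence the interior of {f = 0} is relatively closed in W1; it contains
   W1 /\ V1, where Psi = Phi is an isometry, and V1 meets every component of W1.
   Naturality of the Ricci tensor under Psi is obtained from the connection matrices:
   uniqueness of the Levi-Civita connection gives dJ = J (A - C) - B J, with J the Jacobian of
   Psi, A and B the connection matrices of g1 and of the pullback of g2, and C the conformal
   correction; differentiating once more relates the curvatures. *)
Require Import Defs.
From HB Require Import structures.
From mathcomp Require Import all_boot all_order all_algebra.
From mathcomp Require Import all_classical all_reals all_analysis.
From mathcomp Require Import ring lra.
Set Implicit Arguments.
Unset Strict Implicit.
Unset Printing Implicit Defensive.
Import Order.TTheory GRing.Theory Num.Theory.
Import numFieldNormedType.Exports.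
Local Open Scope classical_set_scope.
Local Open Scope ring_scope.

(** * Differential calculus *)

Section Germs.
Context {R : realType} {V W : normedModType R}.
Implicit Types f g : V -> W.

(** The first-order expansion of [f] at [x] is also one of [g], and uniqueness of the differential
    identifies the two linear maps. *)
Lemma near_eq_differential f g (x : V) :
  {near x, f =1 g} -> differentiable f x ->
  differentiable g x /\ 'd g x = 'd f x :> (V -> W).
Proof.
move=> fg df; have [dfc dfE] := (diff_locallyP _ _).1 df.
have fgx : f x = g x by exact: nbhs_singleton fg.
have gE : g \o shift x = cst (g x) + 'd f x +o_ 0 id.
  apply/eqaddoP => e e0; move/eqaddoP/(_ e e0): dfE.
  move: fg; rewrite (near_shift (0 : V) x).
  apply: filterS2 => z /=; rewrite subr0 => fgz.
  by rewrite !fctE /= fgz fgx.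
have dgE := diff_unique dfc gE.
split; last exact: dgE.
by apply/diff_locallyP; rewrite dgE; split; [exact: dfc|exact: gE].
Qed.

Lemma near_eq_differentiable f g (x : V) :
  {near x, f =1 g} -> differentiable f x -> differentiable g x.
Proof. by move=> fg /(near_eq_differential fg)[]. Qed.

Lemma open_eq_near f g (U : set V) : open U -> {in U, f =1 g} ->
  forall x, U x -> {near x, f =1 g}.
Proof.
move=> oU fg x Ux; near=> z; apply: fg; rewrite inE.
by near: z; exact: open_nbhs_nbhs.
Unshelve. all: by end_near. Qed.

(** Reduces directional derivatives to one variable, so that the mean value theorem and Gronwall's
    inequality apply along segments. *)
Lemma derive_line f (a u : V) (t : R) : differentiable f (a + t *: u) ->
  is_derive t 1 (fun s => f (a + s *: u)) ('D_u f (a + t *: u)).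
Proof.
move=> df.
have dg : is_diff t (fun s : R => a + s *: u) (fun s => s *: u).
  have := @is_diffD R R V (cst a) ( *:%R^~ u) (0) ( *:%R^~ u) t _ _.
  by rewrite add0r; exact.
have dfg : is_diff t (f \o (fun s : R => a + s *: u))
    ('d f (a + t *: u) \o (fun s => s *: u)).
  by apply: is_diff_comp => //; exact/differentiableP.
have dfgt : differentiable (f \o (fun s : R => a + s *: u)) t.
  exact: ex_diff.
split; first by apply: diff_derivable.
rewrite deriveE // [LHS](congr1 (fun F : R -> W => F 1) (@diff_val _ _ _ _ _ _ _ dfg)).
by rewrite /= scale1r deriveE.
Qed.

End Germs.

Section CkOn.
Context {R : realType} {V W : normedModType R}.
Implicit Types (f g : V -> W) (U : set V).

Lemma Ck_on_eq k U f g : open U -> {in U, f =1 g} -> Ck_on k U f -> Ck_on k U g.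
Proof.
elim: k f g => [|k IH] f g oU fg /=.
  move=> fc x Ux.
  have fgx := open_eq_near oU fg Ux.
  rewrite /prop_for /continuous_at -(fg x) ?inE//.
  by apply: cvg_trans (fc x Ux); apply: near_eq_cvg; apply: filterS fgx => z ->.
move=> [fd fk]; split.
  by move=> x Ux; apply: near_eq_differentiable (fd x Ux); exact: open_eq_near fg x Ux.
move=> v; apply: IH (fk v) => // x; rewrite inE => Ux.
by have [_ ->] := near_eq_differential (open_eq_near oU fg Ux) (fd x Ux).
Qed.

Lemma smooth_on_eq U f g : open U -> {in U, f =1 g} -> smooth_on U f -> smooth_on U g.
Proof. by move=> oU fg sf k; exact: Ck_on_eq oU fg (sf k). Qed.

Lemma smooth_on_differentiable U f x : smooth_on U f -> U x -> differentiable f x.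
Proof. by move=> /(_ 1%N)[/(_ x)]. Qed.

Lemma smooth_on_derive U f v : open U -> smooth_on U f -> smooth_on U ('D_v f).
Proof.
move=> oU sf; apply: (@smooth_on_eq _ (fun x => 'd f x v)) => //.
  by move=> x; rewrite inE => Ux; rewrite deriveE //; exact: smooth_on_differentiable Ux.
by move=> k; have [_ /(_ v)] := sf k.+1.
Qed.

Lemma smooth_on_subset U U' f : U' `<=` U -> smooth_on U f -> smooth_on U' f.
Proof.
move=> UU sf k; move: (sf k); elim: k f {sf} => [|k IH] f /=.
  by move=> fc x /UU; exact: fc.
by move=> [fd fk]; split=> [x /UU/fd//|v]; exact: IH.
Qed.

End CkOn.

(* Both mixed derivatives are mean values of the same second difference over small
   parallelograms. *)
Section Schwarz.
Context {R : realType} {V : normedModType R}.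
Implicit Types (f : V -> R^o) (U : set V).

Lemma MVT_line f (a v : V) (h : R) : 0 < h ->
  (forall t, 0 <= t <= h -> differentiable f (a + t *: v)) ->
  exists2 t, 0 <= t <= h & f (a + h *: v) - f a = 'D_v f (a + t *: v) * h.
Proof.
move=> h0 df; pose psi t : R := f (a + t *: v).
have dpsi t : 0 <= t <= h -> is_derive t 1 psi ('D_v f (a + t *: v)).
  by move=> th; apply: derive_line; exact: df.
have [t tI Et] := @MVT R psi (fun t => 'D_v f (a + t *: v)) 0 h h0
  (fun t (tI : t \in `]0, h[%R) => dpsi t (subset_itv_oo_cc tI))
  (derivable_within_continuous
     (fun t (tI : t \in `[0, h]%R) => @ex_derive _ _ _ _ _ _ _ (dpsi t tI))).
exists t; first exact: subset_itv_oo_cc tI.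
by move: Et; rewrite /psi scale0r addr0 subr0.
Qed.

(** The second difference is the increment over [0, h] of s |-> f(x + hv + su) - f(x + su). The mean
    value theorem in s leaves an increment of ['D_u f] along v, to which it applies again. *)
Lemma second_difference f (x u v : V) (h : R) : 0 < h ->
  (forall s t, 0 <= s <= h -> 0 <= t <= h -> differentiable f (x + s *: u + t *: v)
     /\ differentiable ('D_u f) (x + s *: u + t *: v)) ->
  exists s t, [/\ 0 <= s <= h, 0 <= t <= h &
    f (x + h *: u + h *: v) - f (x + h *: u) - f (x + h *: v) + f x
    = 'D_v ('D_u f) (x + s *: u + t *: v) * h ^+ 2].
Proof.
move=> h0 hf.
have hh : 0 <= h <= h by apply/andP; split; [exact: ltW|exact: lexx].
have h00 : (0 : R) <= 0 <= h by apply/andP; split; [exact: lexx|exact: ltW].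
pose phi := fun s : R => (f (x + h *: v + s *: u) - f (x + s *: u) : R).
have dphi s : 0 <= s <= h -> is_derive s 1 phi
    ('D_u f (x + h *: v + s *: u) - 'D_u f (x + s *: u)).
  move=> sh; apply: is_deriveB; apply: derive_line.
    by rewrite addrAC; have [] := hf s h sh hh.
  by have [] := hf s 0 sh h00; rewrite scale0r addr0.
have [s /itvP si Es] : exists2 s, s \in `]0, h[%R & phi h - phi 0 =
    ('D_u f (x + h *: v + s *: u) - 'D_u f (x + s *: u)) * (h - 0).
  apply: (@MVT R phi) => // [s /itvP si|].
    by apply: dphi; rewrite !si.
  apply: derivable_within_continuous => s /itvP si.
  by apply: (@ex_derive _ _ _ _ _ _ _ (dphi s _)); rewrite !si.
have sh : 0 <= s <= h by rewrite !si.
have [t th Et] := @MVT_line ('D_u f) (x + s *: u) v h h0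
  (fun t th => (hf s t sh th).2).
exists s, t; split; [exact: sh|exact: th|].
have E1 : phi h - phi 0 = f (x + h *: u + h *: v) - f (x + h *: u) - f (x + h *: v) + f x.
  by rewrite /phi !scale0r !addr0 (addrAC x) opprB addrA addrAC.
rewrite -E1 Es (addrAC x).
by rewrite Et subr0 -mulrA -expr2.
Qed.

Lemma ball_parallelogram (x u v : V) (r h s t : R) : 0 < h ->
  h * (2 * (`|u| + `|v| + 1)) = r -> 0 <= s <= h -> 0 <= t <= h ->
  ball x r (x + s *: u + t *: v).
Proof.
move=> h0 <- /andP[s0 sh] /andP[t0 th]; rewrite -ball_normE /=.
rewrite -addrA opprD addrA subrr add0r normrN.
rewrite (le_lt_trans (ler_normD _ _)) // !normrZ !ger0_norm //.
have : s * `|u| <= h * `|u| by rewrite ler_wpM2r.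
have : t * `|v| <= h * `|v| by rewrite ler_wpM2r.
have : 0 <= h * `|u| by rewrite mulr_ge0 // ltW.
have : 0 <= h * `|v| by rewrite mulr_ge0 // ltW.
nra.
Qed.

Lemma derive_comm U f (x u v : V) : open U -> smooth_on U f -> U x ->
  'D_v ('D_u f) x = 'D_u ('D_v f) x.
Proof.
move=> oU sf Ux.
have near_lt (c : V -> R^o) : {for x, continuous c} ->
    forall e, 0 < e -> \forall y \near x, `|c x - c y| < e.
  by move=> /cvgrPdist_lt.
pose a := 'D_v ('D_u f) : V -> R^o; pose b := 'D_u ('D_v f) : V -> R^o.
have sa : smooth_on U a by do 2! apply: smooth_on_derive => //.
have sb : smooth_on U b by do 2! apply: smooth_on_derive => //.
have ca : {for x, continuous a} by exact: (sa 0%N).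
have cb : {for x, continuous b} by exact: (sb 0%N).
apply/eqP/contraT => neq; change (is_true (a x != b x)) in neq.
(* With both mixed derivatives within half the gap of their values at [x], they cannot take a common
   value, even at different points. *)
pose e := `|a x - b x| / 2.
have e0 : 0 < e by rewrite divr_gt0 // normr_gt0 subr_eq0.
have /nbhs_ballP[r /= r0 Br] : \forall y \near x, [/\ U y, `|a x - a y| < e & `|b x - b y| < e].
  have Una := near_lt a ca e e0; have Unb := near_lt b cb e e0.
  have UnU : nbhs x U by exact: open_nbhs_nbhs.
  by apply: filterS3 Una Unb UnU => y ? ? ?; split.
(* The side is small enough for the whole parallelogram to stay in the ball; the [+ 1] keeps the
   denominator positive when u = v = 0. *)
pose h := r / (2 * (`|u| + `|v| + 1)).
have D0 : 0 < `|u| + `|v| + 1 by rewrite ltr_wpDl // addr_ge0.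
have h0 : 0 < h by rewrite divr_gt0 // mulr_gt0.
have hr : h * (2 * (`|u| + `|v| + 1)) = r by rewrite /h divfK // lt0r_neq0 // mulr_gt0.
have small s t : 0 <= s <= h -> 0 <= t <= h -> ball x r (x + s *: u + t *: v).
  exact: ball_parallelogram h0 hr.
clearbody h.
have [s [t [sh th E1]]] : exists s t, [/\ 0 <= s <= h, 0 <= t <= h &
    f (x + h *: u + h *: v) - f (x + h *: u) - f (x + h *: v) + f x
    = a (x + s *: u + t *: v) * h ^+ 2].
  apply: second_difference => // s t sh th; have [Uy _ _] := Br _ (small s t sh th).
  split; first exact: smooth_on_differentiable sf Uy.
  exact: smooth_on_differentiable (smooth_on_derive u oU sf) Uy.
have [s' [t' [sh' th' E2]]] : exists s t, [/\ 0 <= s <= h, 0 <= t <= h &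
    f (x + h *: v + h *: u) - f (x + h *: v) - f (x + h *: u) + f x
    = b (x + s *: v + t *: u) * h ^+ 2].
  apply: second_difference => // s' t' sh' th'.
  have [Uy _ _] := Br _ (small t' s' th' sh').
  rewrite addrAC; split; first exact: smooth_on_differentiable sf Uy.
  exact: smooth_on_differentiable (smooth_on_derive v oU sf) Uy.
clear sa sb; clearbody a b.
(* The second difference is symmetric in u and v, so both mean values equal the same number divided
   by h^2. *)
have E : a (x + s *: u + t *: v) = b (x + t' *: u + s' *: v).
  apply: (@mulIf _ (h ^+ 2)); first by rewrite expf_neq0 // lt0r_neq0.
  apply: etrans (esym E1) _; rewrite (addrAC (f _)) (addrAC x (h *: u)).
  by apply: etrans E2 _; congr (b _ * _); rewrite addrAC.
have [_ A _] := Br _ (small s t sh th).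
have [_ _ B] := Br _ (small t' s' th' sh').
have : `|a x - b x| < e + e.
  rewrite -(subrKA (a (x + s *: u + t *: v))) (le_lt_trans (ler_normD _ _)) //.
  by rewrite ltrD // E distrC.
by rewrite /e -splitr ltxx.
Qed.

End Schwarz.

(** * Algebra of connections *)

Section ConnectionAlgebra.
Context {R : realFieldType} {n : nat}.
Implicit Types (G H J : 'M[R]_n) (A B C Q : 'I_n -> 'M[R]_n).

Lemma sum_deltal (i : 'I_n) (F : 'I_n -> R) : \sum_m (m == i)%:R * F m = F i.
Proof.
rewrite (bigD1 i) //= eqxx mul1r big1 ?addr0 // => m /negPf ->.
by rewrite mul0r.
Qed.

Lemma sum_deltar (i : 'I_n) (F : 'I_n -> R) : \sum_m F m * (m == i)%:R = F i.
Proof. by under eq_bigr do rewrite mulrC; exact: sum_deltal. Qed.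

(* The connection matrices are (A_i)^k_l = Gamma^k_{il} and [dA i j] stands for the
   derivative of [A j] in direction i. *)
Definition curvature A (dA : 'I_n -> 'I_n -> 'M[R]_n) (i j : 'I_n) : 'M[R]_n :=
  dA i j - dA j i + (A i *m A j - A j *m A i).

Definition ricci_trace A dA (l j : 'I_n) : R := \sum_k curvature A dA k j k l.

Definition torsion_free A := forall i j k, A i k j = A j k i.

Definition metric_compatible G (dG : 'I_n -> 'M[R]_n) A :=
  forall i, dG i = G *m A i + (G *m A i)^T.

(** Lower the index of the difference of the two connections. The result is skew in its two matrix
    indices by compatibility, and symmetric in the direction and the column index by vanishing
    torsion. Alternating the two symmetries returns T to its own opposite. *)
Lemma levi_civita_unique G dG A A' : G \in unitmx ->
  metric_compatible G dG A -> metric_compatible G dG A' ->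
  torsion_free A -> torsion_free A' -> forall i, A i = A' i.
Proof.
move=> uG cA cA' tA tA'.
pose T i := G *m (A i - A' i).
have Tskew i j k : T i j k = - T i k j.
  have : T i + (T i)^T = 0.
    rewrite /T mulmxBr linearB /= addrACA -opprD.
    by rewrite -cA -cA' subrr.
  by move/matrixP/(_ j k); rewrite !mxE => /eqP; rewrite addr_eq0 => /eqP.
have Tsym i j k : T i j k = T k j i.
  by rewrite !mxE; apply: eq_bigr => m _; rewrite !mxE tA tA'.
have T0 i j k : T i j k = 0.
  have : T i j k = - T i j k.
    by rewrite {1}Tskew Tsym Tskew Tsym Tskew Tsym !opprK.
  lra.
move=> i; apply/eqP; rewrite -subr_eq0; apply/eqP.
rewrite -[LHS](mulKmx uG) (_ : G *m _ = 0) ?mulmx0 //.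
by apply/matrixP => j k; rewrite [LHS]T0 mxE.
Qed.

(** The metric and its first derivatives are independent data at a single point, so that the algebra
    involves no differentiation. *)
Definition christoffel_of G (dG : 'I_n -> 'M[R]_n) (k i j : 'I_n) : R :=
  2^-1 * \sum_l invmx G k l * (dG i j l + dG j i l - dG l i j).

Lemma christoffel_of_torsion_free G dG : (forall i, (dG i)^T = dG i) ->
  torsion_free (fun i => \matrix_(k, l) christoffel_of G dG k i l).
Proof.
move=> dGs i j k; rewrite !mxE /christoffel_of; congr (_ * _); apply: eq_bigr => l _.
have -> : dG l i j = dG l j i by rewrite -{1}(dGs l) mxE.
by rewrite (addrC (dG i j l)).
Qed.

Lemma christoffel_of_compatible G dG : G \in unitmx ->
  (forall i, (dG i)^T = dG i) ->
  metric_compatible G dG (fun i => \matrix_(k, l) christoffel_of G dG k i l).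
Proof.
move=> uG dGs i.
(* Christoffel symbols of the first kind; adding the transpose cancels the last two derivatives and
   leaves [dG i]. *)
pose D i : 'M[R]_n := \matrix_(l, j) (2^-1 * (dG i j l + dG j i l - dG l i j)).
have -> : \matrix_(k, l) christoffel_of G dG k i l = invmx G *m D i.
  apply/matrixP => k l; rewrite !mxE /christoffel_of mulr_sumr; apply: eq_bigr => m _.
  by rewrite !mxE mulrCA.
rewrite mulKVmx //; apply/matrixP => j k; rewrite !mxE.
have -> : dG i k j = dG i j k by rewrite -{1}(dGs i) mxE.
lra.
Qed.

(** * Curvature under a conformal change of metric *)

Section Conformal.
Variables (G : 'M[R]_n) (dG A : 'I_n -> 'M[R]_n) (dA : 'I_n -> 'I_n -> 'M[R]_n).
Variables (th w : 'I_n -> R) (dth dw : 'I_n -> 'I_n -> R).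

(* The difference of the Levi-Civita connections of e^{2f} h and h, where th = df,
   G = e^{2f} h and w is the G-gradient of f. *)
Definition conformal_shift (i : 'I_n) : 'M[R]_n :=
  \matrix_(k, l) (th i * (k == l)%:R + (k == i)%:R * th l - w k * G i l).

(** The product rule applied to the shift of index j: [dth i j], [dw i k] and [dG i j l] stand for
    the derivatives of [th j], [w k] and [G j l] in direction i. *)
Definition d_conformal_shift (i j : 'I_n) : 'M[R]_n :=
  \matrix_(k, l) (dth i j * (k == l)%:R + (k == j)%:R * dth i l
                  - (dw i k * G j l + w k * dG i j l)).

Hypothesis Gsym : forall i j, G i j = G j i.
Hypothesis Gw : forall i, \sum_k G i k * w k = th i.

Let C := conformal_shift.

Lemma conformal_shift_torsion_free : torsion_free C.
Proof. by move=> i j k; rewrite !mxE (Gsym i j); ring. Qed.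

Lemma metric_conformal_shift i : G *m C i =
  \matrix_(k, l) (th i * G k l + G k i * th l - th k * G i l).
Proof.
apply/matrixP => k l; rewrite !mxE.
transitivity (\sum_m ((th i * G k m) * (m == l)%:R + (G k m * th l) * (m == i)%:R
                      - (G k m * w m) * G i l)).
  by apply: eq_bigr => m _; rewrite !mxE; ring.
by rewrite big_split sumrN big_split /= !sum_deltar -mulr_suml Gw.
Qed.

(** This is the term that differentiating the factor e^{2f} contributes to [dG i]; subtracting the
    shift therefore passes from compatibility with e^{2f} h to compatibility with h. *)
Lemma conformal_shift_metric i :
  G *m C i + (G *m C i)^T = (2 * th i) *: G.
Proof.
by rewrite metric_conformal_shift; apply/matrixP => k l; rewrite !mxE (Gsym l k)
  (Gsym i k) (Gsym i l); ring.
Qed.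

Hypothesis dGA : metric_compatible G dG A.
Hypothesis tA : torsion_free A.
Hypothesis dth_sym : forall i j, dth i j = dth j i.
Hypothesis Gdw : forall i j, \sum_k (dG i j k * w k + G j k * dw i k) = dth i j.

(** [N] is |df|^2, [hess] the covariant Hessian of f for the connection [A], and [nu] the covariant
    derivative of the gradient. *)
Let N := \sum_m th m * w m.
Let hess i l := dth i l - \sum_m A i m l * th m.
Let nu i k := dw i k + \sum_m A i k m * w m.

Let dGE i j k : dG i j k = \sum_m G j m * A i m k + \sum_m G k m * A i m j.
Proof. by rewrite dGA !mxE. Qed.

(** Lowering an index commutes with covariant differentiation because [A] is compatible with the
    metric. *)
Let Gnu i j : \sum_k nu i k * G k j = hess i j.
Proof.
rewrite /hess -Gdw.
transitivity (\sum_k G j k * dw i k + \sum_k \sum_m G j k * A i k m * w m).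
  rewrite -big_split; apply: eq_bigr => k _; rewrite /= /nu Gsym mulrDl mulrC mulr_suml.
  by congr (_ + _); apply: eq_bigr => m _; ring.
rewrite big_split /= [X in _ = X - _]addrC -addrA; congr (_ + _).
transitivity (\sum_k (\sum_m G j m * A i m k * w k + \sum_m G k m * A i m j * w k)
  - \sum_m A i m j * th m).
  rewrite big_split /= exchange_big /= -addrA -[LHS]addr0; congr (_ + _).
  apply/esym/eqP; rewrite subr_eq0 exchange_big; apply/eqP; apply: eq_bigr => m _ /=.
  rewrite -Gw mulr_sumr; apply: eq_bigr => k _; rewrite (Gsym k m); ring.
congr (_ - _); apply: eq_bigr => k _.
by rewrite dGE mulrDl !mulr_suml.
Qed.

(** The mixed products are expressed through [nu - dw] here and [dth - hess] in [CA], so that the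
    plain derivatives cancel against those in [d_conformal_shift] and only covariant ones survive in
    the curvature. *)
Let AC i j k l : (A i *m C j) k l =
  th j * A i k l + A i k j * th l - (nu i k - dw i k) * G j l.
Proof.
rewrite mxE.
transitivity (\sum_m ((th j * A i k m) * (m == l)%:R + (A i k m * th l) * (m == j)%:R
                      - (A i k m * w m) * G j l)).
  by apply: eq_bigr => m _; rewrite !mxE; ring.
rewrite big_split sumrN big_split /= !sum_deltar -mulr_suml /nu.
by congr (_ - _ * _); rewrite addrC addKr.
Qed.

Let CA i j k l : (C j *m A i) k l =
  th j * A i k l + (k == j)%:R * (dth i l - hess i l) - w k * \sum_m G j m * A i m l.
Proof.
rewrite mxE.
transitivity (\sum_m ((th j * A i m l) * (m == k)%:R + (k == j)%:R * (A i m l * th m)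
                      - w k * (G j m * A i m l))).
  by apply: eq_bigr => m _; rewrite !mxE (eq_sym k m); ring.
rewrite big_split sumrN big_split /= sum_deltar -!mulr_sumr /hess.
by congr (_ + _ * _ - _); rewrite opprB addrC subrK.
Qed.

Let CC i j k l : (C i *m C j) k l =
  th i * C j k l + (k == i)%:R * (2 * th j * th l - N * G j l)
  - w k * (th j * G i l + G i j * th l - th i * G j l).
Proof.
have <- : (G *m C j) i l = th j * G i l + G i j * th l - th i * G j l.
  by rewrite metric_conformal_shift mxE.
have E : \sum_m th m * C j m l = 2 * th j * th l - N * G j l.
  transitivity (\sum_m ((th j * th m) * (m == l)%:R + (th m * th l) * (m == j)%:R
                      - (th m * w m) * G j l)).
    by apply: eq_bigr => m _; rewrite !mxE; ring.
  rewrite big_split sumrN big_split /= !sum_deltar -mulr_suml -/N; ring.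
have -> : (G *m C j) i l = \sum_m G i m * C j m l by rewrite mxE.
rewrite mxE -E.
transitivity (\sum_m ((th i * C j m l) * (m == k)%:R + (k == i)%:R * (th m * C j m l)
                      - w k * (G i m * C j m l))).
  by apply: eq_bigr => m _; rewrite [C i k m]mxE (eq_sym k m); ring.
by rewrite big_split sumrN big_split /= sum_deltar -!mulr_sumr.
Qed.

Lemma curvature_conformal i j k l :
  curvature (fun i => A i - C i) (fun i j => dA i j - d_conformal_shift i j) i j k l =
  curvature A dA i j k l
  - ((k == j)%:R * hess i l - nu i k * G j l - (k == i)%:R * hess j l + nu j k * G i l)
  + ((k == i)%:R * th j * th l - (k == j)%:R * th i * th l
     - N * ((k == i)%:R * G j l - (k == j)%:R * G i l)
     + w k * (th i * G j l - th j * G i l)).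
Proof.
rewrite /curvature !mulmxBl !mulmxBr.
have mB (X Y : 'M[R]_n) : (X - Y) k l = X k l - Y k l by rewrite !mxE.
have mD (X Y : 'M[R]_n) : (X + Y) k l = X k l + Y k l by rewrite !mxE.
rewrite !(mB, mD) !AC !CA !CC !mxE !dGE (dth_sym i j) (tA i j k) (Gsym j i).
have -> : \sum_m G l m * A i m j = \sum_m G l m * A j m i.
  by apply: eq_bigr => m _; rewrite tA.
ring.
Qed.

(** Trace of the curvature law. It is the usual law for rescaling by e^{2 phi} with phi = -f, since
    [A - C] belongs to h = e^{-2f} G; this explains the signs. *)
Lemma ricci_conformal l j :
  ricci_trace (fun i => A i - C i) (fun i j => dA i j - d_conformal_shift i j) l j =
  ricci_trace A dA l j + (n%:R - 2) * (hess j l + th j * th l)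
  + (\sum_k nu k k - (n%:R - 2) * N) * G j l.
Proof.
rewrite /ricci_trace.
under eq_bigr do rewrite curvature_conformal.
rewrite big_split big_split /= sumrN -[LHS]addrA -[RHS]addrA; congr (_ + _).
have sumc (c : R) : \sum_(k < n) c = n%:R * c by rewrite sumr_const card_ord mulr_natl.
have -> : \sum_k ((k == j)%:R * hess k l - nu k k * G j l - (k == k)%:R * hess j l
    + nu j k * G k l) = hess j l - (\sum_k nu k k) * G j l - n%:R * hess j l + hess j l.
  rewrite big_split big_split big_split /= sum_deltal Gnu !sumrN -mulr_suml.
  by under [in X in _ - X + _]eq_bigr do rewrite eqxx mul1r; rewrite sumc.
have -> : \sum_k ((k == k)%:R * th j * th l - (k == j)%:R * th k * th l
    - N * ((k == k)%:R * G j l - (k == j)%:R * G k l) + w k * (th k * G j l - th j * G k l))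
    = n%:R * (th j * th l) - th j * th l - N * (n%:R * G j l - G j l)
      + (N * G j l - th j * th l).
  transitivity (\sum_k ((th j * th l - N * G j l)
     + (k == j)%:R * (N * G k l - th k * th l) + (th k * w k) * G j l - th j * (G l k * w k))).
    by apply: eq_bigr => k _; rewrite eqxx mulr1n (Gsym l k); ring.
  rewrite big_split big_split big_split /= sum_deltal sumrN sumc -mulr_suml -mulr_sumr Gw -/N.
  ring.
ring.
Qed.

Hypothesis uG : G \in unitmx.
Hypothesis n3 : (3 <= n)%N.

(* Taking the trace of the vanishing of both Ricci tensors determines the Laplacian of f,
   and with it the whole Hessian. *)
Lemma ricci_flat_conformal :
  (forall l j, ricci_trace A dA l j = 0) ->
  (forall l j, ricci_trace (fun i => A i - C i)
                 (fun i j => dA i j - d_conformal_shift i j) l j = 0) ->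
  forall i j, dth i j = \sum_k A i k j * th k - th i * th j + 2^-1 * N * G i j.
Proof.
move=> r0 r1 i j.
pose D := \sum_k nu k k; pose kap := D - (n%:R - 2) * N.
have E p q : (n%:R - 2) * (hess p q + th p * th q) + kap * G p q = 0.
  by have := ricci_conformal q p; rewrite r1 r0 add0r => ->.
(* [X] is the tensor of [E] with its second index raised; it vanishes because [X *m G] does, and its
   matrix trace is the metric trace of [E]. *)
pose X : 'M[R]_n := \matrix_(p, k) ((n%:R - 2) * (nu p k + th p * w k) + kap * (p == k)%:R).
have X0 : X = 0.
  suff XG : X *m G = 0 by rewrite -[X](mulmxK uG) XG mul0mx.
  apply/matrixP => p q; rewrite [RHS]mxE -[RHS](E p q) -(Gnu p q) mxE -(Gw q).
  transitivity (\sum_k ((n%:R - 2) * (nu p k * G k q) + (n%:R - 2) * th p * (G q k * w k)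
     + (k == p)%:R * (kap * G k q))).
    by apply: eq_bigr => k _; rewrite mxE (Gsym q k) (eq_sym p k); ring.
  rewrite big_split big_split /= sum_deltal -!mulr_sumr; ring.
have tr0 : (n%:R - 2) * (D + N) + n%:R * kap = 0.
  have : \sum_k X k k = 0 by rewrite X0; apply: big1 => k _; rewrite mxE.
  under eq_bigr do rewrite mxE eqxx mulr1.
  by rewrite big_split /= -mulr_sumr big_split /= sumr_const card_ord -[kap *+ n]mulr_natl.
have n3R : (3 : R) <= n%:R by rewrite ler_nat.
(* Eliminating [D] between [tr0] and the definition of [kap] gives 2(n-1) kap = -(n-2)(n-1) N. *)
have kE : kap = - (n%:R - 2) * (2^-1 * N).
  apply: (@mulfI _ (2 * (n%:R - 1))).
    by rewrite lt0r_neq0 // ?mulr_gt0 // subr_gt0 (lt_le_trans _ n3R) // ?ltr1n ?ltr_nat.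
  have -> : 2 * (n%:R - 1) * kap = ((n%:R - 2) * (D + N) + n%:R * kap)
       + (n%:R - 2) * kap - (n%:R - 2) * (D + N) by ring.
  by rewrite tr0 /kap; field.
(* Both terms of [E] now carry the factor n - 2, which is nonzero for n >= 3. *)
have : hess i j + th i * th j = 2^-1 * N * G i j.
  apply: (@mulfI _ (n%:R - 2)).
    by rewrite lt0r_neq0 // ?mulr_gt0 // subr_gt0 (lt_le_trans _ n3R) // ?ltr1n ?ltr_nat.
  by move/eqP: (E i j); rewrite addr_eq0 => /eqP ->; rewrite kE; ring.
by rewrite /hess => <-; ring.
Qed.

End Conformal.

(** * Pullback of connections and naturality of the Ricci tensor *)

Section Pullback.
Variables (J : 'M[R]_n) (uJ : J \in unitmx).

(** The first hypothesis says that J intertwines the connections Q and B. Symmetry of the second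
    derivatives of J is its integrability condition, which is the intertwining of the curvatures. *)
Lemma curvature_gauge (Q B dJ : 'I_n -> 'M[R]_n) (dQ dB ddJ : 'I_n -> 'I_n -> 'M[R]_n) :
  (forall i, dJ i = J *m Q i - B i *m J) ->
  (forall k i, ddJ k i = dJ k *m Q i + J *m dQ k i - (dB k i *m J + B i *m dJ k)) ->
  (forall k i, ddJ k i = ddJ i k) ->
  forall k i, J *m curvature Q dQ k i = curvature B dB k i *m J.
Proof.
move=> dJE ddJE ddJs k i; apply/eqP; rewrite -subr_eq0; apply/eqP.
rewrite -[RHS](subrr (ddJ k i)) {2}ddJs !ddJE !dJE /curvature.
rewrite !(mulmxDr, mulmxDl, mulmxN, mulNmx) !mulmxA.
move: (J *m dQ k i) (J *m dQ i k) (J *m Q k *m Q i) (J *m Q i *m Q k)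
  (dB k i *m J) (dB i k *m J) (B k *m B i *m J) (B i *m B k *m J)
  (B k *m J *m Q i) (B i *m J *m Q k) => X1 X2 X3 X4 X5 X6 X7 X8 X9 X10.
apply/matrixP => a b; rewrite !mxE; ring.
Qed.

Variables (A' : 'I_n -> 'M[R]_n) (dA' : 'I_n -> 'I_n -> 'M[R]_n).

Definition pullback_connection (i : 'I_n) : 'M[R]_n := \sum_a J a i *: A' a.

(* [dJ k a i] is the derivative of [J a i] in direction k. *)
Definition d_pullback_connection (dJ : 'I_n -> 'M[R]_n) (k i : 'I_n) : 'M[R]_n :=
  \sum_a (dJ k a i *: A' a + J a i *: \sum_b J b k *: dA' b a).

(** The terms containing [dJ] are symmetric in k and i and drop out on antisymmetrisation; what
    remains is tensorial. *)
Lemma curvature_pullback (dJ : 'I_n -> 'M[R]_n) k i :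
  (forall a, dJ k a i = dJ i a k) ->
  curvature pullback_connection (d_pullback_connection dJ) k i =
  \sum_a \sum_b (J a i * J b k) *: curvature A' dA' b a.
Proof.
move=> dJs.
have mulB p q : pullback_connection p *m pullback_connection q =
    \sum_a \sum_b (J a q * J b p) *: (A' b *m A' a).
  rewrite /pullback_connection mulmx_suml exchange_big /=; apply: eq_bigr => b _.
  by rewrite mulmx_sumr; apply: eq_bigr => a _; rewrite -scalemxAl -scalemxAr scalerA mulrC.
have mulB' : pullback_connection i *m pullback_connection k =
    \sum_a \sum_b (J a i * J b k) *: (A' a *m A' b).
  by rewrite mulB exchange_big; apply: eq_bigr => b _; apply: eq_bigr => a _; rewrite mulrC.
have dB p q : d_pullback_connection dJ p q =
    \sum_a dJ p a q *: A' a + \sum_a \sum_b (J a q * J b p) *: dA' b a.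
  rewrite /d_pullback_connection big_split /=; congr (_ + _); apply: eq_bigr => a _.
  by rewrite scaler_sumr; apply: eq_bigr => b _; rewrite scalerA.
have dB' : d_pullback_connection dJ i k =
    \sum_a dJ k a i *: A' a + \sum_a \sum_b (J a i * J b k) *: dA' a b.
  rewrite dB; congr (_ + _); first by apply: eq_bigr => a _; rewrite dJs.
  by rewrite exchange_big; apply: eq_bigr => b _; apply: eq_bigr => a _; rewrite mulrC.
rewrite /curvature dB dB' mulB mulB' opprD [X in X + _ = _]addrACA subrr add0r -!sumrB -big_split.
apply: eq_bigr => a _; rewrite /= -!sumrB -big_split; apply: eq_bigr => b _.
by rewrite /= -!scalerBr -scalerDr.
Qed.

(** The curvature of Q is that of A' pulled back by J in its form indices and conjugated by J. In
    the trace one factor J meets the inverse of J, leaving the pullback of the Ricci tensor of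
    A'. *)
Lemma ricci_pullback (Q dJ : 'I_n -> 'M[R]_n) (dQ ddJ : 'I_n -> 'I_n -> 'M[R]_n) :
  (forall k i a, dJ k a i = dJ i a k) ->
  (forall i, dJ i = J *m Q i - pullback_connection i *m J) ->
  (forall k i, ddJ k i = dJ k *m Q i + J *m dQ k i
     - (d_pullback_connection dJ k i *m J + pullback_connection i *m dJ k)) ->
  (forall k i, ddJ k i = ddJ i k) ->
  (forall l j, ricci_trace A' dA' l j = 0) ->
  forall l j, ricci_trace Q dQ l j = 0.
Proof.
move=> dJs dJE ddJE ddJs r0 l j.
have cE k : curvature Q dQ k j =
    \sum_a \sum_b (J a j * J b k) *: (invmx J *m curvature A' dA' b a *m J).
  rewrite -[LHS](mulKmx uJ) (curvature_gauge dJE ddJE ddJs) curvature_pullback //.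
  rewrite mulmxA mulmx_sumr mulmx_suml; apply: eq_bigr => a _.
  rewrite mulmx_sumr mulmx_suml; apply: eq_bigr => b _.
  by rewrite -scalemxAr -scalemxAl.
have JK b p : \sum_k J b k * invmx J k p = (p == b)%:R.
  by have /matrixP/(_ b p) := mulmxV uJ; rewrite !mxE eq_sym.
transitivity (\sum_a \sum_q (J a j * J q l) * ricci_trace A' dA' q a); last first.
  by apply: big1 => a _; apply: big1 => q _; rewrite r0 mulr0.
rewrite /ricci_trace.
under eq_bigr do rewrite cE summxE.
rewrite exchange_big; apply: eq_bigr => a _ /=.
under eq_bigr do rewrite summxE.
rewrite exchange_big /=.
under [RHS]eq_bigr do rewrite mulr_sumr.
rewrite [RHS]exchange_big; apply: eq_bigr => b _ /=.
transitivity (\sum_k \sum_q \sum_p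
    (J a j * J q l * curvature A' dA' b a p q) * (J b k * invmx J k p)).
  apply: eq_bigr => k _; rewrite !mxE mulr_sumr; apply: eq_bigr => q _.
  by rewrite mxE mulr_suml mulr_sumr; apply: eq_bigr => p _; ring.
rewrite exchange_big; apply: eq_bigr => q _ /=; rewrite exchange_big /=.
under eq_bigr do rewrite -mulr_sumr JK.
by rewrite sum_deltar.
Qed.

(* The pulled back connection is J^{-1} dJ + J^{-1} B J with B the pullback of the matrices A';
   uniqueness of the Levi-Civita connection identifies it up to the conformal shift. *)
Lemma levi_civita_conformal_pullback (G H : 'M[R]_n) (A dG dH dJ : 'I_n -> 'M[R]_n)
    (th w : 'I_n -> R) (e : R) :
  (forall i j, G i j = G j i) -> (H^T = H) -> G \in unitmx ->
  (forall i, \sum_k G i k * w k = th i) ->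
  G = e *: (J^T *m H *m J) ->
  (forall i, dG i = (2 * th i) *: G + e *: ((dJ i)^T *m H *m J
     + J^T *m (\sum_a J a i *: dH a) *m J + J^T *m H *m dJ i)) ->
  metric_compatible G dG A -> metric_compatible H dH A' ->
  torsion_free A -> torsion_free A' ->
  (forall k i a, dJ k a i = dJ i a k) ->
  forall i, dJ i = J *m (A i - conformal_shift G th w i) - pullback_connection i *m J.
Proof.
move=> Gs Hs uG Gw GE dGE cA cA' tA tA' dJs i.
pose B := pullback_connection.
pose Q i := invmx J *m (dJ i + B i *m J).
have JQ k : J *m Q k = dJ k + B k *m J by rewrite /Q mulKVmx.
suff -> : A i = Q i + conformal_shift G th w i by rewrite addrK JQ addrK.
apply: (@levi_civita_unique G dG A (fun i => Q i + conformal_shift G th w i)) => //.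
- move=> k; rewrite mulmxDr linearD /= addrACA conformal_shift_metric // addrC dGE.
  congr (_ + _).
  have GQ : G *m Q k = e *: (J^T *m H *m (dJ k + B k *m J)).
    by rewrite {1}GE -scalemxAl -mulmxA JQ.
  have dHE : \sum_a J a k *: dH a = H *m B k + (H *m B k)^T.
    rewrite /B /pullback_connection mulmx_sumr raddf_sum -big_split; apply: eq_bigr => a _ /=.
    by rewrite cA' scalerDr -scalemxAr linearZ.
  rewrite dHE GQ linearZ /= -scalerDr; congr (_ *: _).
  rewrite !trmx_mul !linearD /= !trmx_mul Hs trmxK !(mulmxDl, mulmxDr) !mulmxA.
  move: (_ *m B k *m J) (J^T *m (B k)^T *m H *m J) ((dJ k)^T *m H *m J) (J^T *m H *m dJ k)
    => X1 X2 X3 X4.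
  by apply/matrixP => a b; rewrite !mxE; ring.
- move=> p q k; rewrite !mxE; congr (_ + _); last first.
    by have := @conformal_shift_torsion_free G th w Gs p q k; rewrite !mxE.
  apply: eq_bigr => m _; congr (_ * _); rewrite !mxE dJs; congr (_ + _).
  transitivity (\sum_c \sum_a J a p * A' a m c * J c q).
    apply: eq_bigr => c _; rewrite summxE mulr_suml; apply: eq_bigr => a _.
    by rewrite mxE.
  rewrite exchange_big; apply: eq_bigr => a _ /=; rewrite summxE mulr_suml.
  by apply: eq_bigr => c _; rewrite mxE tA'; ring.
Qed.

End Pullback.

End ConnectionAlgebra.

(** * Partial derivatives of real functions on R^n *)

Section PartialDerivatives.
Context {R : realType} {n : nat}.
Implicit Types (f g : 'rV[R]_n -> R) (y : 'rV[R]_n) (U : set 'rV[R]_n).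

Definition rdiff f y : Prop := differentiable (f : 'rV[R]_n -> R^o) y.

Lemma rdiff_cst (c : R) y : rdiff (fun=> c) y.
Proof. exact: differentiable_cst. Qed.

Lemma rdiffD f g y : rdiff f y -> rdiff g y -> rdiff (fun z => f z + g z) y.
Proof. exact: differentiableD. Qed.

Lemma rdiffB f g y : rdiff f y -> rdiff g y -> rdiff (fun z => f z - g z) y.
Proof. exact: differentiableB. Qed.

Lemma rdiffM f g y : rdiff f y -> rdiff g y -> rdiff (fun z => f z * g z) y.
Proof. exact: differentiableM. Qed.

Lemma rdiffV f y : f y != 0 -> rdiff f y -> rdiff (fun z => (f z)^-1) y.
Proof. by move=> f0 df; exact: differentiableV. Qed.

Lemma rdiff_sum (I : Type) (r : seq I) (P : pred I) (h : I -> 'rV[R]_n -> R) y :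
  (forall i, rdiff (h i) y) -> rdiff (fun z => \sum_(i <- r | P i) h i z) y.
Proof.
move=> dh; elim: r => [|i r IH].
  by under eq_fun do rewrite big_nil; exact: rdiff_cst.
under eq_fun do rewrite big_cons; case: (P i) => //.
exact: rdiffD.
Qed.

Lemma rdiff_prod (I : Type) (r : seq I) (P : pred I) (h : I -> 'rV[R]_n -> R) y :
  (forall i, rdiff (h i) y) -> rdiff (fun z => \prod_(i <- r | P i) h i z) y.
Proof.
move=> dh; elim: r => [|i r IH].
  by under eq_fun do rewrite big_nil; exact: rdiff_cst.
under eq_fun do rewrite big_cons; case: (P i) => //.
exact: rdiffM.
Qed.

Lemma rdiff_continuous f y : rdiff f y -> {for y, continuous (f : _ -> R^o)}.
Proof. exact: differentiable_continuous. Qed.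

Lemma rdiff_near f g y : {near y, f =1 g} -> rdiff f y -> rdiff g y.
Proof. exact: near_eq_differentiable. Qed.

Lemma partial_near (i : 'I_n) f g y : {near y, f =1 g} -> partial i f y = partial i g y.
Proof. exact: near_eq_derive. Qed.

Lemma partial_cst (i : 'I_n) (c : R) y : partial i (fun=> c) y = 0.
Proof. exact: (@derive_cst R _ R^o c). Qed.

Lemma partialD (i : 'I_n) f g y : rdiff f y -> rdiff g y ->
  partial i (fun z => f z + g z) y = partial i f y + partial i g y.
Proof. by move=> df dg; apply: deriveD; exact: diff_derivable. Qed.

Lemma partialB (i : 'I_n) f g y : rdiff f y -> rdiff g y ->
  partial i (fun z => f z - g z) y = partial i f y - partial i g y.
Proof. by move=> df dg; apply: deriveB; exact: diff_derivable. Qed.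

Lemma partialM (i : 'I_n) f g y : rdiff f y -> rdiff g y ->
  partial i (fun z => f z * g z) y = partial i f y * g y + f y * partial i g y.
Proof.
move=> df dg; rewrite addrC [_ * g y]mulrC.
by apply: (@deriveM R _ f g); exact: diff_derivable.
Qed.

Lemma partial_sum (i : 'I_n) (I : Type) (r : seq I) (h : I -> 'rV[R]_n -> R) y :
  (forall k, rdiff (h k) y) ->
  partial i (fun z => \sum_(k <- r) h k z) y = \sum_(k <- r) partial i (h k) y.
Proof.
move=> dh; elim: r => [|k r IH].
  by under eq_fun do rewrite big_nil; rewrite partial_cst big_nil.
under eq_fun do rewrite big_cons.
by rewrite partialD // ?IH ?big_cons //; exact: rdiff_sum.
Qed.

Lemma partial_diff (i : 'I_n) f y : rdiff f y ->
  partial i f y = 'd (f : _ -> R^o) y (delta_mx 0 i).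
Proof. exact: deriveE. Qed.

Lemma diff_rowE (F : 'rV[R]_n -> 'rV[R]_n) y (i : 'I_n) : differentiable F y ->
  'd F y (delta_mx 0 i) = \row_a partial i (fun z => F z 0 a) y.
Proof.
move=> dF; rewrite -deriveE // derive_mx; last exact: diff_derivable.
by apply/matrixP => p q; rewrite !mxE ord1.
Qed.

Lemma rdiff_coord (F : 'rV[R]_n -> 'rV[R]_n) y (a : 'I_n) : differentiable F y ->
  rdiff (fun z => F z 0 a) y.
Proof.
move=> dF; apply: (@differentiable_comp _ _ _ _ F (fun N : 'rV[R]_n => N 0 a)) => //.
exact: differentiable_coord.
Qed.

Lemma rdiff_comp (F : 'rV[R]_n -> 'rV[R]_n) g y :
  differentiable F y -> rdiff g (F y) -> rdiff (fun z => g (F z)) y.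
Proof. exact: differentiable_comp. Qed.

Lemma partial_comp (F : 'rV[R]_n -> 'rV[R]_n) g y (i : 'I_n) :
  differentiable F y -> rdiff g (F y) ->
  partial i (fun z => g (F z)) y =
  \sum_a partial i (fun z => F z 0 a) y * partial a g (F y).
Proof.
move=> dF dg; rewrite partial_diff; last exact: rdiff_comp.
rewrite (@diff_comp _ _ _ _ F (g : _ -> R^o)) // /comp diff_rowE //.
rewrite [X in 'd _ _ X]row_sum_delta linear_sum; apply: eq_bigr => a _.
by rewrite linearZ /= mxE (partial_diff a dg).
Qed.

Lemma rdiff_expR f y : rdiff f y -> rdiff (fun z => expR (f z)) y.
Proof.
move=> df; apply: (@differentiable_comp _ _ _ _ (f : _ -> R^o) (expR : R^o -> R^o)) => //.
by apply/derivable1_diffP; exact: derivable_expR.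
Qed.

Lemma partial_expR f y (i : 'I_n) : rdiff f y ->
  partial i (fun z => expR (f z)) y = partial i f y * expR (f y).
Proof.
move=> df.
have de : differentiable (expR : R^o -> R^o) (f y).
  by apply/derivable1_diffP; exact: derivable_expR.
rewrite partial_diff; last exact: rdiff_expR.
rewrite (@diff_comp _ _ _ _ (f : _ -> R^o) (expR : R^o -> R^o)) // /comp -partial_diff //.
rewrite deriv1E; last exact: derivable_expR.
rewrite derive1E; congr (_ * _); exact: (congr1 (fun h : R -> R => h (f y)) (derive_expR R)).
Qed.

Lemma smooth_rdiff U f y : smooth_on U (f : _ -> R^o) -> U y -> rdiff f y.
Proof. exact: smooth_on_differentiable. Qed.

Lemma smooth_partial U f i : open U -> smooth_on U (f : _ -> R^o) ->
  smooth_on U (partial i f : _ -> R^o).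
Proof. exact: smooth_on_derive. Qed.

Lemma partial_comm U f i j y : open U -> smooth_on U (f : _ -> R^o) -> U y ->
  partial i (partial j f) y = partial j (partial i f) y.
Proof. by move=> oU sf Uy; exact: derive_comm oU sf Uy. Qed.

End PartialDerivatives.

(** * The Hessian of the conformal factor *)

Section MatrixCalculus.
Context {R : realType} {n : nat}.
Implicit Types (y : 'rV[R]_n) (U : set 'rV[R]_n).

Definition mdiff p q (X : 'rV[R]_n -> 'M[R]_(p, q)) y :=
  forall a b, rdiff (fun z => X z a b) y.

Definition dmx p q (i : 'I_n) (X : 'rV[R]_n -> 'M[R]_(p, q)) y : 'M[R]_(p, q) :=
  \matrix_(a, b) partial i (fun z => X z a b) y.

Lemma dmxE p q i (X : 'rV[R]_n -> 'M[R]_(p, q)) y a b :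
  dmx i X y a b = partial i (fun z => X z a b) y.
Proof. by rewrite mxE. Qed.

Lemma mdiff_mx p q (X : 'I_p -> 'I_q -> 'rV[R]_n -> R) y :
  (forall a b, rdiff (X a b) y) -> mdiff (fun z => \matrix_(a, b) X a b z) y.
Proof. by move=> dX a b; under eq_fun do rewrite mxE; exact: dX. Qed.

Lemma mdiffM p q r (X : 'rV[R]_n -> 'M[R]_(p, q)) (Y : 'rV[R]_n -> 'M[R]_(q, r)) y :
  mdiff X y -> mdiff Y y -> mdiff (fun z => X z *m Y z) y.
Proof.
move=> dX dY; move=> a b; under eq_fun do rewrite mxE.
by apply: rdiff_sum => k; apply: rdiffM.
Qed.

Lemma mdiffB p q (X Y : 'rV[R]_n -> 'M[R]_(p, q)) y :
  mdiff X y -> mdiff Y y -> mdiff (fun z => X z - Y z) y.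
Proof.
by move=> dX dY a b; under eq_fun do rewrite 2!mxE; apply: rdiffB.
Qed.

Lemma mdiffT p q (X : 'rV[R]_n -> 'M[R]_(p, q)) y :
  mdiff X y -> mdiff (fun z => (X z)^T) y.
Proof. by move=> dX a b; under eq_fun do rewrite mxE; exact: dX. Qed.

Lemma dmxM p q r (X : 'rV[R]_n -> 'M[R]_(p, q)) (Y : 'rV[R]_n -> 'M[R]_(q, r)) y i :
  mdiff X y -> mdiff Y y ->
  dmx i (fun z => X z *m Y z) y = dmx i X y *m Y y + X y *m dmx i Y y.
Proof.
move=> dX dY; apply/matrixP => a b; rewrite !mxE.
under [X in partial i X]eq_fun do rewrite mxE.
rewrite partial_sum; last by move=> k; apply: rdiffM.
rewrite -big_split; apply: eq_bigr => k _.
by rewrite partialM // !mxE.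
Qed.

Lemma dmxB p q (X Y : 'rV[R]_n -> 'M[R]_(p, q)) y i :
  mdiff X y -> mdiff Y y -> dmx i (fun z => X z - Y z) y = dmx i X y - dmx i Y y.
Proof.
move=> dX dY; apply/matrixP => a b; rewrite !mxE.
by under [X in partial i X]eq_fun do rewrite 2!mxE; rewrite partialB.
Qed.

Lemma dmxZ p q (c : 'rV[R]_n -> R) (X : 'rV[R]_n -> 'M[R]_(p, q)) y i :
  rdiff c y -> mdiff X y ->
  dmx i (fun z => c z *: X z) y = partial i c y *: X y + c y *: dmx i X y.
Proof.
move=> dc dX; apply/matrixP => a b; rewrite !mxE.
by under [X in partial i X]eq_fun do rewrite mxE; rewrite partialM.
Qed.

Lemma dmxT p q (X : 'rV[R]_n -> 'M[R]_(p, q)) y i :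
  dmx i (fun z => (X z)^T) y = (dmx i X y)^T.
Proof.
by apply/matrixP => a b; rewrite !mxE; under [X in partial i X]eq_fun do rewrite mxE.
Qed.

Lemma dmx_near p q (X Y : 'rV[R]_n -> 'M[R]_(p, q)) y i :
  {near y, X =1 Y} -> dmx i X y = dmx i Y y.
Proof.
move=> XY; apply/matrixP => a b; rewrite !mxE; apply: partial_near.
by apply: filterS XY => z ->.
Qed.

Lemma rdiff_det p (X : 'rV[R]_n -> 'M[R]_p) y : mdiff X y -> rdiff (fun z => \det (X z)) y.
Proof.
move=> dX; rewrite /determinant; apply: rdiff_sum => s.
by apply: rdiffM; [exact: rdiff_cst|apply: rdiff_prod].
Qed.

(** Near [y] the inverse is the adjugate divided by the determinant, and both are polynomial in the
    entries. *)
Lemma mdiff_invmx p (X : 'rV[R]_n -> 'M[R]_p) U y :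
  open U -> U y -> (forall z, U z -> X z \in unitmx) -> mdiff X y ->
  mdiff (fun z => invmx (X z)) y.
Proof.
move=> oU Uy uX dX a b.
apply: (@rdiff_near _ _ (fun z => (\det (X z))^-1 * \adj (X z) a b)).
  have : nbhs y U by exact: open_nbhs_nbhs.
  by apply: filterS => z /uX uz; rewrite /invmx uz [RHS]mxE.
apply: rdiffM; first apply: rdiffV; last 2 first.
- exact: rdiff_det.
- under eq_fun do rewrite mxE.
  apply: rdiffM; first exact: rdiff_cst.
  by apply: rdiff_det => c d; under eq_fun do rewrite !mxE; exact: dX.
by have := uX y Uy; rewrite unitmxE unitfE.
Qed.

Section Connection.
Variables (U : set 'rV[R]_n) (G : 'rV[R]_n -> 'M[R]_n).
Hypothesis oU : open U.
Hypothesis sG : forall i j, smooth_on U (fun z => G z i j : R^o).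
Hypothesis symG : forall z, (G z)^T = G z.
Hypothesis uG : forall z, U z -> G z \in unitmx.

Definition conn y (i : 'I_n) : 'M[R]_n :=
  \matrix_(k, l) christoffel_of (G y) (fun i => dmx i G y) k i l.

Definition dconn y (i j : 'I_n) : 'M[R]_n := dmx i (fun z => conn z j) y.

Lemma metric_mdiff y : U y -> mdiff G y.
Proof. by move=> Uy a b; exact: smooth_rdiff (sG a b) Uy. Qed.

Lemma inv_metric_mdiff y : U y -> mdiff (fun z => invmx (G z)) y.
Proof. by move=> Uy; apply: (mdiff_invmx oU Uy uG); exact: metric_mdiff. Qed.

Lemma dmx_metric_sym y i : (dmx i G y)^T = dmx i G y.
Proof. by rewrite -dmxT; under eq_fun do rewrite symG. Qed.

Lemma conn_torsion_free y : torsion_free (conn y).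
Proof. by apply: christoffel_of_torsion_free => i; exact: dmx_metric_sym. Qed.

Lemma conn_compatible y : U y -> metric_compatible (G y) (fun i => dmx i G y) (conn y).
Proof.
move=> Uy; apply: christoffel_of_compatible; first exact: uG.
by move=> i; exact: dmx_metric_sym.
Qed.

Lemma conn_mdiff y i : U y -> mdiff (fun z => conn z i) y.
Proof.
move=> Uy; apply: mdiff_mx => k l; apply: rdiffM; first exact: rdiff_cst.
apply: rdiff_sum => m; apply: rdiffM; first exact: inv_metric_mdiff.
have dd a b c : rdiff (fun z => dmx a G z b c) y.
  under eq_fun do rewrite mxE.
  exact: smooth_rdiff (smooth_partial a oU (sG b c)) Uy.
by apply: rdiffB; first apply: rdiffD; exact: dd.
Qed.

End Connection.
End MatrixCalculus.

(** * The Hessian equation for conformal Ricci-flat metrics in coordinates *)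

Section HessianEquation.
Context {R : realType} {n : nat}.
Variables (U U' : set 'rV[R]_n) (G H : 'rV[R]_n -> 'M[R]_n).
Variables (f : 'rV[R]_n -> R) (F : 'rV[R]_n -> 'rV[R]_n).
Hypotheses (oU : open U) (oU' : open U') (FU : forall y, U y -> U' (F y)).
Hypothesis sG : forall i j, smooth_on U (fun z => G z i j : R^o).
Hypothesis sH : forall i j, smooth_on U' (fun z => H z i j : R^o).
Hypothesis sf : smooth_on U (f : _ -> R^o).
Hypothesis sF : forall a, smooth_on U (fun z => F z 0 a : R^o).
Hypothesis dF : forall y, U y -> differentiable F y.
Hypotheses (symG : forall z, (G z)^T = G z) (symH : forall z, (H z)^T = H z).
Hypotheses (uG : forall z, U z -> G z \in unitmx) (uH : forall z, U' z -> H z \in unitmx).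

Definition jacob (y : 'rV[R]_n) : 'M[R]_n := \matrix_(a, i) partial i (fun z => F z 0 a) y.

Lemma jacob_entry a i : (fun z => jacob z a i) = partial i (fun z => F z 0 a).
Proof. by apply/funext => z; rewrite mxE. Qed.

Hypothesis GE : forall y, U y ->
  G y = expR (2 * f y) *: ((jacob y)^T *m H (F y) *m jacob y).

Definition grad_covector (y : 'rV[R]_n) (i : 'I_n) : R := partial i f y.
Definition gradient (y : 'rV[R]_n) (k : 'I_n) : R :=
  \sum_l invmx (G y) k l * grad_covector y l.

Let J := jacob.
Let th := grad_covector.
Let w := gradient.
Let dJ y i := dmx i J y.
Let B y := pullback_connection (J y) (conn H (F y)).
Let C y := conformal_shift (G y) (th y) (w y).

Let GsymE y i j : G y i j = G y j i.
Proof. by rewrite -{1}symG mxE. Qed.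

Let Gw y : U y -> forall i, \sum_k G y i k * w y k = th y i.
Proof.
move=> Uy i; have E : G y *m (invmx (G y) *m \col_l th y l) = \col_l th y l.
  by rewrite mulKVmx //; exact: uG.
move/matrixP/(_ i 0): E; rewrite [in RHS]mxE => <-; rewrite mxE.
apply: eq_bigr => k _; rewrite mxE; congr (_ * _).
by apply: eq_bigr => l _; rewrite mxE.
Qed.

Let th_rdiff y i : U y -> rdiff (fun z => th z i) y.
Proof. by move=> Uy; exact: smooth_rdiff (smooth_partial i oU sf) Uy. Qed.

Let w_rdiff y k : U y -> rdiff (fun z => w z k) y.
Proof.
move=> Uy; apply: rdiff_sum => l; apply: rdiffM; last exact: th_rdiff.
exact: (inv_metric_mdiff oU sG uG).
Qed.

Let J_mdiff y : U y -> mdiff J y.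
Proof.
move=> Uy; apply: mdiff_mx => a i.
exact: smooth_rdiff (smooth_partial i oU (sF a)) Uy.
Qed.

Let dJ_sym y k i a : U y -> dJ y k a i = dJ y i a k.
Proof.
move=> Uy; rewrite [LHS]dmxE [RHS]dmxE (jacob_entry a i) (jacob_entry a k).
exact: partial_comm oU (sF a) Uy.
Qed.

(** Taking determinants in [GE], invertibility of [G] forces that of the Jacobian. *)
Let J_unit y : U y -> J y \in unitmx.
Proof.
move=> Uy; have := uG Uy; rewrite (GE Uy) !unitmxE detZ !det_mulmx !unitrM.
by case/andP=> _ /andP[].
Qed.

Let HF_mdiff y : U y -> mdiff (fun z => H (F z)) y.
Proof.
move=> Uy a b; apply: (@rdiff_comp _ _ F (fun z => H z a b)); first exact: dF.
exact: smooth_rdiff (sH a b) (FU Uy).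
Qed.

Let dmx_HF y i : U y -> dmx i (fun z => H (F z)) y = \sum_a J y a i *: dmx a H (F y).
Proof.
move=> Uy; apply/matrixP => p q; rewrite mxE summxE.
rewrite (@partial_comp _ _ F (fun z => H z p q)); last 2 first.
- exact: dF.
- exact: smooth_rdiff (sH p q) (FU Uy).
by apply: eq_bigr => a _; rewrite !mxE.
Qed.

Let dmx_metric y i : U y -> dmx i G y = (2 * th y i) *: G y + expR (2 * f y) *:
  ((dJ y i)^T *m H (F y) *m J y + (J y)^T *m (\sum_a J y a i *: dmx a H (F y)) *m J y
   + (J y)^T *m H (F y) *m dJ y i).
Proof.
move=> Uy; pose X z := (J z)^T *m H (F z) *m J z.
have dJT : mdiff (fun z => (J z)^T) y by apply: mdiffT; exact: J_mdiff.
have dJH : mdiff (fun z => (J z)^T *m H (F z)) y by apply: mdiffM; [|exact: HF_mdiff].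
have dX : mdiff X y by apply: mdiffM; [|exact: J_mdiff].
have <- : dmx i X y = (dJ y i)^T *m H (F y) *m J y
    + (J y)^T *m (\sum_a J y a i *: dmx a H (F y)) *m J y + (J y)^T *m H (F y) *m dJ y i.
  rewrite dmxM //; last exact: J_mdiff.
  rewrite dmxM //; last exact: HF_mdiff.
  by rewrite dmxT dmx_HF // mulmxDl.
have near_eq : {near y, G =1 fun z => expR (2 * f z) *: X z}.
  by have : nbhs y U by [exact: open_nbhs_nbhs]; apply: filterS => z /GE.
have d2f : rdiff (fun z => 2 * f z) y.
  by apply: rdiffM; [exact: rdiff_cst|exact: smooth_rdiff sf Uy].
rewrite (dmx_near i near_eq) dmxZ //; last exact: rdiff_expR.
rewrite partial_expR // partialM; [|exact: rdiff_cst|exact: smooth_rdiff sf Uy].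
by rewrite partial_cst mul0r add0r (GE Uy) scalerA.
Qed.

Let dJE y i : U y -> dJ y i = J y *m (conn G y i - C y i) - B y i *m J y.
Proof.
move=> Uy; apply: (levi_civita_conformal_pullback (J_unit Uy) (@GsymE y) (symH (F y))
  (uG Uy) (Gw Uy) (GE Uy)).
- by move=> j; exact: dmx_metric.
- exact: (conn_compatible symG uG).
- exact: (conn_compatible symH uH (FU Uy)).
- exact: conn_torsion_free.
- exact: conn_torsion_free.
- by move=> k j a; exact: dJ_sym.
Qed.

Let dth y i j := partial i (fun z => th z j) y.
Let dw y i k := partial i (fun z => w z k) y.
Let dC y := d_conformal_shift (G y) (fun i => dmx i G y) (w y) (dth y) (dw y).

Let C_mdiff y i : U y -> mdiff (fun z => C z i) y.
Proof.
move=> Uy; apply: mdiff_mx => k l.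
apply: rdiffB; first apply: rdiffD; apply: rdiffM => //; try exact: rdiff_cst.
all: try exact: th_rdiff.
  exact: w_rdiff.
exact: metric_mdiff.
Qed.

Let dmx_C y i j : U y -> dmx i (fun z => C z j) y = dC y i j.
Proof.
move=> Uy; apply/matrixP => k l; rewrite !mxE.
under eq_fun do rewrite mxE.
have d1 := th_rdiff j Uy; have d2 := th_rdiff l Uy; have d3 := w_rdiff k Uy.
have d4 := metric_mdiff sG Uy j l.
rewrite partialB; [|apply: rdiffD; apply: rdiffM|apply: rdiffM] => //; try exact: rdiff_cst.
rewrite partialD; [|apply: rdiffM|apply: rdiffM] => //; try exact: rdiff_cst.
rewrite !partialM //; try exact: rdiff_cst.
by rewrite !partial_cst mul0r mulr0 addr0 add0r.
Qed.

(** Product and chain rule: the formal derivative used in [ricci_pullback] is the actual one. *)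
Let dmx_B y k i : U y -> dmx k (fun z => B z i) y =
  d_pullback_connection (J y) (conn H (F y)) (dconn H (F y)) (dJ y) k i.
Proof.
move=> Uy; apply/matrixP => p q; rewrite mxE summxE.
have dcH a : rdiff (fun z => conn H z a p q) (F y).
  by apply: (conn_mdiff oU' sH uH); exact: FU.
have dcHF a : rdiff (fun z => conn H (F z) a p q) y.
  by apply: (@rdiff_comp _ _ F (fun z => conn H z a p q)); [exact: dF|exact: dcH].
have -> : (fun z => B z i p q) = (fun z => \sum_a J z a i * conn H (F z) a p q).
  by apply/funext => z; rewrite summxE; apply: eq_bigr => a _; rewrite mxE.
rewrite partial_sum; last by move=> a; apply: rdiffM; [exact: J_mdiff|exact: dcHF].
apply: eq_bigr => a _; rewrite partialM; [|exact: J_mdiff|exact: dcHF].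
transitivity (dJ y k a i * conn H (F y) a p q
    + J y a i * \sum_b J y b k * dconn H (F y) b a p q); last first.
  apply/esym; rewrite [LHS]mxE; congr (_ + _); rewrite [LHS]mxE //; congr (_ * _).
  by rewrite summxE; apply: eq_bigr => b _; rewrite [LHS]mxE.
congr (_ * _ + _ * _); first by rewrite [RHS]dmxE.
rewrite (@partial_comp _ _ F (fun z => conn H z a p q)); [|exact: dF|exact: dcH].
apply: eq_bigr => b _; congr (_ * _); last by rewrite [RHS]dmxE.
by rewrite [RHS]mxE.
Qed.

Let B_mdiff y i : U y -> mdiff (fun z => B z i) y.
Proof.
move=> Uy p q.
have -> : (fun z => B z i p q) = (fun z => \sum_a J z a i * conn H (F z) a p q).
  by apply/funext => z; rewrite summxE; apply: eq_bigr => a _; rewrite mxE.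
apply: rdiff_sum => a; apply: rdiffM; first exact: J_mdiff.
apply: (@rdiff_comp _ _ F (fun z => conn H z a p q)); first exact: dF.
by apply: (conn_mdiff oU' sH uH); exact: FU.
Qed.

Hypothesis ricG : forall y, U y -> forall l j, ricci_trace (conn G y) (dconn G y) l j = 0.
Hypothesis ricH : forall y, U' y -> forall l j, ricci_trace (conn H y) (dconn H y) l j = 0.
Hypothesis n3 : (3 <= n)%N.

(** By [dJE], the matrices [conn G y i - C y i] are the gauge transform by J of the pullback of the
    connection of [H], so their Ricci trace is a pullback of the vanishing one of [H]. *)
Let ric_shift y : U y -> forall l j,
  ricci_trace (fun i => conn G y i - C y i) (fun i j => dconn G y i j - dC y i j) l j = 0.
Proof.
move=> Uy.
apply: (@ricci_pullback _ _ (J y) (J_unit Uy) (conn H (F y)) (dconn H (F y)) _ (dJ y) _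
  (fun k i => dmx k (fun z => dJ z i) y)).
- by move=> k i a; exact: dJ_sym.
- by move=> i; exact: dJE.
- move=> k i.
  (* The equation [dJE] holds on the open set U, hence may be differentiated at [y]. *)
  have near_eq : {near y, (fun z => dJ z i) =1
      fun z => J z *m (conn G z i - C z i) - B z i *m J z}.
    have : nbhs y U by exact: open_nbhs_nbhs.
    by apply: filterS => z Uz; exact: dJE.
  have dcG : mdiff (fun z => conn G z i) y by exact: (conn_mdiff oU sG uG).
  have dQ : mdiff (fun z => conn G z i - C z i) y by apply: mdiffB; [|exact: C_mdiff].
  have dJy := J_mdiff Uy; have dB := B_mdiff i Uy.
  rewrite (dmx_near k near_eq) dmxB; [|exact: mdiffM|exact: mdiffM].
  rewrite !dmxM // dmxB //; last exact: C_mdiff.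
  by rewrite dmx_C // dmx_B.
(* Second derivatives of J are third derivatives of F; they commute by Schwarz's theorem applied to
   a first partial derivative of a component of F. *)
- have dJ_fun p a b : (fun z => dJ z p a b) = partial p (partial b (fun z => F z 0 a)).
    by apply/funext => z; rewrite [LHS]dmxE (jacob_entry a b).
  have ddE p q a b : dmx p (fun z => dJ z q) y a b =
      partial p (partial q (partial b (fun z => F z 0 a))) y.
    by rewrite [LHS]dmxE dJ_fun.
  move=> k i; apply/matrixP => a b.
  apply: etrans (ddE k i a b) (etrans _ (esym (ddE i k a b))).
  exact: partial_comm oU (smooth_partial b oU (sF a)) Uy.
- exact: ricH (FU Uy).
Qed.

Lemma ricci_flat_hessian y i j : U y ->
  partial i (partial j f) y = \sum_k conn G y i k j * grad_covector y k
   - grad_covector y i * grad_covector y j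
   + 2^-1 * (\sum_m grad_covector y m * gradient y m) * G y i j.
Proof.
move=> Uy.
apply: (@ricci_flat_conformal _ _ (G y) (fun i => dmx i G y) (conn G y) (dconn G y)
  (th y) (w y) (dth y) (dw y)).
- by move=> p q; exact: GsymE.
- exact: Gw.
- exact: (conn_compatible symG uG).
- exact: conn_torsion_free.
- by move=> p q; exact: partial_comm oU sf Uy.
- move=> p q.
  (* Differentiating the identity G w = df, which holds near [y], gives the relation between [dw]
     and [dth]. *)
  have near_eq : {near y, (fun z => th z q) =1 (fun z => \sum_k G z q k * w z k)}.
    have : nbhs y U by exact: open_nbhs_nbhs.
    by apply: filterS => z Uz; rewrite Gw.
  rewrite /dth (partial_near p near_eq) partial_sum; last first.
    by move=> k; apply: rdiffM; [exact: metric_mdiff|exact: w_rdiff].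
  apply: eq_bigr => k _; rewrite partialM; [|exact: metric_mdiff|exact: w_rdiff].
  by rewrite mxE.
- exact: uG.
- exact: n3.
- exact: ricG.
- exact: ric_shift.
Qed.

End HessianEquation.

(** * Gronwall's inequality and uniqueness for linear first-order systems *)

Section Gronwall.
Context {R : realType}.

Lemma gronwall0 (phi dphi : R -> R) (L : R) :
  (forall t : R, 0 <= t <= 1 -> is_derive t 1 phi (dphi t)) ->
  (forall t : R, 0 <= t <= 1 -> dphi t <= L * phi t) -> phi 0 = 0 -> phi 1 <= 0.
Proof.
move=> dphiE dphi_le phi0.
(* With the integrating factor the differential inequality says that [psi] is nonincreasing. *)
pose psi t := phi t * expR (- L * t).
have dpsi (t : R) : 0 <= t <= 1 ->
    is_derive t 1 psi (phi t *: (- L * expR (- L * t)) + expR (- L * t) *: dphi t).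
  move=> tI; have := dphiE t tI => dphit.
  have de : is_derive t 1 (fun s : R => expR (- L * s)) (- L * expR (- L * t)).
    have dl : is_derive t 1 (fun s : R => - L * s) (- L).
      by have := @is_deriveZ R R^o R^o id (- L) t 1 1 _; rewrite /GRing.scale /= mulr1; exact.
    rewrite [- L * expR _]mulrC.
    exact: (@is_derive1_comp R expR (fun s : R => - L * s) t _ _ (is_derive_expR _) dl).
  exact: is_deriveM.
have : psi 1 <= psi 0.
  apply: (@ler0_derive1_nincr R psi 0 1) => //.
  - move=> t /subset_itv_oo_cc tI; exact: (@ex_derive _ _ _ _ _ _ _ (dpsi t tI)).
  - move=> t /subset_itv_oo_cc tI; rewrite derive1E (@derive_val _ _ _ _ _ _ _ (dpsi t tI)).
    have e0 : 0 <= expR (- L * t) by exact: expR_ge0.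
    have := dphi_le t tI; rewrite -subr_le0 => le0.
    have -> : phi t *: (- L * expR (- L * t)) + expR (- L * t) *: dphi t
      = expR (- L * t) * (dphi t - L * phi t) :> R by rewrite /GRing.scale /=; ring.
    exact: mulr_ge0_le0.
  - apply: derivable_within_continuous => t tI.
    exact: (@ex_derive _ _ _ _ _ _ _ (dpsi t tI)).
rewrite /psi phi0 mul0r pmulr_lle0 //; exact: expR_gt0.
Qed.

Lemma segment_in_ball (V : normedModType R) (c z x : V) (r t : R) :
  ball c r z -> ball c r x -> 0 <= t <= 1 -> ball c r (z + t *: (x - z)).
Proof.
rewrite -!ball_normE /= => zr xr /andP[t0 t1].
have -> : c - (z + t *: (x - z)) = (1 - t) *: (c - z) + t *: (c - x).
  rewrite scalerBl scale1r -addrA [- _ + _]addrC -scalerBr.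
  have -> : c - x - (c - z) = - (x - z) by rewrite !opprB addrC addrA subrK.
  by rewrite scalerN opprD addrA.
rewrite (le_lt_trans (ler_normD _ _)) // !normrZ !ger0_norm ?subr_ge0 //.
(* For t > 0 strictness comes from the term of [x]; at t = 0 that term vanishes and it must come
   from [z]. *)
have [->|tn0] := eqVneq t 0; first by rewrite subr0 mul0r mul1r addr0.
have tp : 0 < t by rewrite lt_neqAle eq_sym tn0.
have : t * `|c - x| < t * r by rewrite ltr_pM2l.
have : (1 - t) * `|c - z| <= (1 - t) * r by rewrite ler_wpM2l ?subr_ge0 // ltW.
lra.
Qed.

Context {n : nat}.
Implicit Types (y : 'rV[R]_n).

Lemma derive_partial (g : 'rV[R]_n -> R) y (v : 'rV[R]_n) : rdiff g y ->
  'D_v (g : _ -> R^o) y = \sum_i v 0 i * partial i g y.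
Proof.
move=> dg; rewrite deriveE // {1}[v]row_sum_delta linear_sum; apply: eq_bigr => i _.
by rewrite linearZ /= (partial_diff i dg).
Qed.

(** Cauchy-Schwarz against the constant vector, by summing |a_i||a_j| <= (a_i^2 + a_j^2)/2 over all
    pairs. *)
Lemma sum_mul_le_squares (I : finType) (a : I -> R) :
  (\sum_i `|a i|) ^+ 2 <= #|I|%:R * \sum_i a i ^+ 2.
Proof.
rewrite expr2 mulr_suml.
have -> : #|I|%:R * \sum_i a i ^+ 2 = \sum_i \sum_j 2^-1 * (a i ^+ 2 + a j ^+ 2).
  transitivity (\sum_i (2^-1 * (#|I|%:R * a i ^+ 2) + 2^-1 * \sum_j a j ^+ 2)).
    by rewrite big_split /= -!mulr_sumr sumr_const -[_ *+ #|I|]mulr_natl; field.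
  apply: eq_bigr => i _; rewrite -mulr_sumr big_split /= sumr_const mulr_natl; ring.
apply: ler_sum => i _; rewrite mulr_sumr; apply: ler_sum => j _.
rewrite -(real_normK (num_real (a i))) -(real_normK (num_real (a j))).
have := sqr_ge0 (`|a i| - `|a j|); lra.
Qed.

(* Along a segment, the squared norm of th satisfies a linear differential inequality. *)
Lemma linear_system_unique (c : 'rV[R]_n) (r K : R) (th : 'I_n -> 'rV[R]_n -> R)
    (M : 'I_n -> 'I_n -> 'I_n -> 'rV[R]_n -> R) :
  (forall y j, ball c r y -> rdiff (th j) y) ->
  (forall y i j, ball c r y -> partial i (th j) y = \sum_k M i j k y * th k y) ->
  (forall y i j k, ball c r y -> `|M i j k y| <= K) ->
  forall z x, ball c r z -> ball c r x -> (forall j, th j z = 0) -> forall j, th j x = 0.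
Proof.
move=> dth thE MK z x zr xr th0 j0.
pose v := x - z; pose l t := z + t *: v.
have lB (t : R) : 0 <= t <= 1 -> ball c r (l t) by move=> tI; exact: segment_in_ball.
have K0 : 0 <= K by exact: le_trans (normr_ge0 _) (MK z j0 j0 j0 zr).
pose phi t : R := \sum_j th j (l t) ^+ 2.
(* The derivative of [th j] along the segment, as prescribed by the system. *)
pose d j t : R := \sum_i v 0 i * \sum_k M i j k (l t) * th k (l t).
pose V := \sum_i `|v 0 i|.
have dphi (t : R) : 0 <= t <= 1 -> is_derive t 1 phi (\sum_j 2 * (th j (l t) * d j t)).
  move=> tI.
  have dj j : is_derive t 1 (fun s => th j (l s) ^+ 2) (2 * (th j (l t) * d j t)).
    have dt : is_derive t 1 (fun s => th j (l s)) (d j t).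
      have := derive_line (dth (l t) j (lB t tI)).
      rewrite (derive_partial _ (dth (l t) j (lB t tI))).
      by under eq_bigr do rewrite (thE _ _ _ (lB t tI)).
    have := is_deriveM dt dt.
    have -> : th j (l t) *: d j t + th j (l t) *: d j t = 2 * (th j (l t) * d j t) :> R.
      by rewrite /GRing.scale /=; ring.
    by under [X in _ -> is_derive _ _ X _]eq_fun do rewrite expr2.
  have := @is_derive_sum R R^o R^o n (fun j s => th j (l s) ^+ 2) t 1 _ dj.
  by rewrite fct_sumE.
suff : phi 1 <= 0.
  rewrite /phi /l scale1r /v addrC subrK => phi1.
  have : \sum_j th j x ^+ 2 == 0 by rewrite eq_le phi1 sumr_ge0 // => j _; exact: sqr_ge0.
  rewrite psumr_eq0; last by move=> j _; exact: sqr_ge0.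
  by move/allP/(_ j0); rewrite mem_index_enum sqrf_eq0 => /(_ isT)/eqP.
(* The 2 comes from differentiating squares, [V * K] bounds each [d j] by the l^1 norm of th, and n
   is the cost of replacing the squared l^1 norm by [phi]. *)
apply: (@gronwall0 phi _ (2 * (V * K * n%:R)) dphi); last first.
  rewrite /phi /l scale0r addr0; apply: big1 => j _; by rewrite th0 expr0n.
move=> t tI; pose a k := `|th k (l t)|.
have dle j : `|d j t| <= V * K * \sum_k a k.
  rewrite (le_trans (ler_norm_sum _ _ _)) // -mulrA mulr_suml; apply: ler_sum => i _.
  rewrite normrM ler_wpM2l // (le_trans (ler_norm_sum _ _ _)) // mulr_sumr.
  by apply: ler_sum => k _; rewrite normrM ler_wpM2r // MK //; exact: lB.
rewrite -mulr_sumr -[leRHS]mulrA ler_wpM2l //.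
apply: (@le_trans _ _ (V * K * (\sum_k a k) ^+ 2)).
  rewrite expr2 mulrA [X in _ <= X]mulrC mulr_suml; apply: ler_sum => j _.
  rewrite (le_trans (ler_norm _)) // normrM ler_wpM2l //; exact: dle.
rewrite -[leRHS]mulrA ler_wpM2l //.
  by rewrite mulr_ge0 // sumr_ge0.
by have := sum_mul_le_squares (fun k => th k (l t)); rewrite card_ord.
Qed.

End Gronwall.

(** * Local rigidity of the conformal factor *)

Section Rigidity.
Context {R : realType} {n : nat}.
Implicit Types (y : 'rV[R]_n) (U : set 'rV[R]_n).

Lemma rdiff_locally_bounded (g : 'rV[R]_n -> R) y : rdiff g y ->
  \forall z \near y, `|g z| <= `|g y| + 1.
Proof.
move=> /rdiff_continuous/cvgrPdist_lt/(_ 1 ltr01); apply: filterS => z gz.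
rewrite -[g z](subrK (g y)) (le_trans (ler_normD _ _)) // addrC lerD2l.
by rewrite distrC ltW.
Qed.

(** The sum of squares is one locally bounded function dominating every member; the passage from the
    square to [g i] uses 2|a| <= a^2 + 1. *)
Lemma rdiff_family_bounded (I : finType) (g : I -> 'rV[R]_n -> R) y :
  (forall i, rdiff (g i) y) -> exists K, \forall z \near y, forall i, `|g i z| <= K.
Proof.
move=> dg; pose S z := \sum_i g i z ^+ 2.
have dS : rdiff S y.
  by apply: rdiff_sum => i; under eq_fun do rewrite expr2; apply: rdiffM.
exists (`|S y| + 2); apply: filterS (rdiff_locally_bounded dS) => z Sz i.
have giS : g i z ^+ 2 <= S z.
  rewrite /S (bigD1 i) //= lerDl sumr_ge0 // => j _; exact: sqr_ge0.
have S1 := le_trans (ler_norm (S z)) Sz.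
have := sqr_ge0 (`|g i z| - 1).
move: giS S1; rewrite -(real_normK (num_real (g i z))).
move: (`|g i z|) (S z) (`|S y|) (normr_ge0 (S y)) => a b d d0 h1 h2 h3; nra.
Qed.

(** The equation is a linear first-order system for df, so df vanishes on the ball and the mean
    value theorem gives f = 0. The radius depends on [y] alone and not on [z], which is what the
    later closedness argument requires. *)
Lemma hessian_rigidity U (f : 'rV[R]_n -> R) (M : 'I_n -> 'I_n -> 'I_n -> 'rV[R]_n -> R) y :
  open U -> smooth_on U (f : _ -> R^o) -> U y ->
  (forall i j k, rdiff (M i j k) y) ->
  (forall z i j, U z -> partial i (partial j f) z = \sum_k M i j k z * partial k f z) ->
  exists2 r : R, 0 < r & ball y r `<=` U /\
    forall z x, ball y r z -> ball y r x -> f z = 0 -> (forall j, partial j f z = 0) -> f x = 0.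
Proof.
move=> oU sf Uy dM hE.
have [K nK] := @rdiff_family_bounded ('I_n * 'I_n * 'I_n)%type
  (fun p => M p.1.1 p.1.2 p.2) y (fun p => dM _ _ _).
have nU : nbhs y U by exact: open_nbhs_nbhs.
have [r /= r0 Br] := (nbhs_ballP _ _).1 (filterI nU nK).
exists r; first exact: r0.
split; first by move=> z /Br[].
move=> z x zr xr fz thz.
have dth z' j : ball y r z' -> rdiff (partial j f) z'.
  by move=> /Br[Uz _]; exact: smooth_rdiff (smooth_partial j oU sf) Uz.
have th0 : forall x', ball y r x' -> forall j, partial j f x' = 0.
  move=> x' xr'.
  apply: (@linear_system_unique _ _ y r K (fun j => partial j f) M) zr xr' thz.
  - by move=> z' j; exact: dth.
  - by move=> z' i j /Br[Uz _]; exact: hE.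
  - by move=> z' i j k /Br[_ /(_ (i, j, k))].
have df (t : R) : 0 <= t <= 1 -> differentiable (f : _ -> R^o) (z + t *: (x - z)).
  by move=> tI; have [Uz _] := Br _ (segment_in_ball zr xr tI); exact: smooth_rdiff sf Uz.
have [t tI E] := MVT_line ltr01 df.
have zx : z + 1 *: (x - z) = x by rewrite scale1r addrC subrK.
move: E; rewrite zx fz subr0 => ->.
rewrite derive_partial; last exact: df.
by rewrite big1 ?mul0r // => i _; rewrite th0 ?mulr0 //; exact: segment_in_ball.
Qed.

Lemma conformal_factor_rigidity (U U' : set 'rV[R]_n) (G H : 'rV[R]_n -> 'M[R]_n)
    (f : 'rV[R]_n -> R) (F : 'rV[R]_n -> 'rV[R]_n) y :
  open U -> open U' -> (forall z, U z -> U' (F z)) ->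
  (forall i j, smooth_on U (fun z => G z i j : R^o)) ->
  (forall i j, smooth_on U' (fun z => H z i j : R^o)) ->
  smooth_on U (f : _ -> R^o) ->
  (forall a, smooth_on U (fun z => F z 0 a : R^o)) ->
  (forall z, U z -> differentiable F z) ->
  (forall z, (G z)^T = G z) -> (forall z, (H z)^T = H z) ->
  (forall z, U z -> G z \in unitmx) -> (forall z, U' z -> H z \in unitmx) ->
  (forall z, U z -> G z = expR (2 * f z) *: ((jacob F z)^T *m H (F z) *m jacob F z)) ->
  (forall z, U z -> forall l j, ricci_trace (conn G z) (dconn G z) l j = 0) ->
  (forall z, U' z -> forall l j, ricci_trace (conn H z) (dconn H z) l j = 0) ->
  (3 <= n)%N -> U y ->
  exists2 r : R, 0 < r & ball y r `<=` U /\
    forall z x, ball y r z -> ball y r x -> f z = 0 -> (forall j, partial j f z = 0) -> f x = 0.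
Proof.
move=> oU oU' FU sG sH sf sF dF symG symH uG uH GE ricG ricH n3 Uy.
have hess z i j := @ricci_flat_hessian R n U U' G H f F oU oU' FU sG sH sf sF dF symG symH
  uG uH GE ricG ricH n3 z i j.
(* The Hessian equation is quadratic in df; one factor of each quadratic term is absorbed into the
   coefficients, which need only be locally bounded. *)
apply: (@hessian_rigidity U f (fun i j k z => conn G z i k j
   - (k == i)%:R * partial j f z + 2^-1 * (gradient G f z k * G z i j))) => //.
- have dth j : rdiff (partial j f) y by exact: smooth_rdiff (smooth_partial j oU sf) Uy.
  move=> i j k; apply: rdiffD; first apply: rdiffB.
  + exact: (conn_mdiff oU sG uG).
  + by apply: rdiffM; [exact: rdiff_cst|exact: dth].
  + apply: rdiffM; first exact: rdiff_cst.
    apply: rdiffM; last exact: (metric_mdiff sG).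
    apply: rdiff_sum => l; apply: rdiffM; last exact: dth.
    exact: (inv_metric_mdiff oU sG uG).
- move=> z i j Uz; rewrite hess //.
  transitivity (\sum_k (conn G z i k j * partial k f z
     - (k == i)%:R * (partial j f z * partial k f z)
     + (2^-1 * G z i j) * (partial k f z * gradient G f z k))).
    rewrite big_split big_split /= sumrN sum_deltal -mulr_sumr /grad_covector.
    by rewrite (mulrC (partial i f z)) (mulrAC 2^-1).
  by apply: eq_bigr => k _; ring.
Qed.

End Rigidity.

(** * Metrics in charts *)

Section ChainGerm.
Context {R : realType} {V1 V2 V3 : normedModType R}.

(** Chain rule for germs: a chart and its inverse cancel only near the point. *)
Lemma diff_comp_near (f : V1 -> V2) (g : V2 -> V3) (h : V1 -> V3) x y v :
  f x = y -> differentiable f x -> differentiable g y -> {near x, g \o f =1 h} ->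
  'd g y ('d f x v) = 'd h x v.
Proof.
move=> <- df dg gfh; apply/esym.
have dgf : differentiable (g \o f) x by exact: differentiable_comp.
have [_ ->] := near_eq_differential gfh dgf.
by rewrite diff_comp.
Qed.

End ChainGerm.

Section SmoothCoord.
Context {R : realType} {n : nat}.

Lemma smooth_on_coord (U : set 'rV[R]_n) (F : 'rV[R]_n -> 'rV[R]_n) a :
  open U -> smooth_on U F -> smooth_on U (fun z => F z 0 a : R^o).
Proof.
move=> oU sF k; move: (sF k); elim: k F {sF} => [|k IH] F /=.
  move=> cF x Ux.
  apply: (@continuous_comp _ _ _ F (fun N : 'rV[R]_n => N 0 a : R^o)); first exact: cF.
  exact: coord_continuous.
move=> [dF kF]; split; first by move=> x Ux; exact: rdiff_coord (dF x Ux).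
move=> v; apply: Ck_on_eq oU _ (IH _ (kF v)) => x; rewrite inE => Ux.
have dx := dF x Ux.
have := deriveE v (rdiff_coord a dx); rewrite /rdiff => <-.
by rewrite -deriveE // derive_mx ?mxE //; exact: diff_derivable.
Qed.

End SmoothCoord.

Lemma open_preimage_on (T T' : topologicalType) (W : set T) (D : set T') (F : T -> T') :
  open W -> (forall p, W p -> {for p, continuous F}) -> open D -> open (W `&` F @^-1` D).
Proof.
move=> oW cF oD; rewrite openE => p [Wp Dp]; rewrite /interior; apply: filterI.
  exact: open_nbhs_nbhs.
by apply: cF => //; exact: open_nbhs_nbhs.
Qed.

Section Charts.
Context {R : realType} {n : nat}.

Lemma chart_image_open (T : topologicalType) (c : chart R n T) (A : set T) :
  open A -> open (c @` (cdom c `&` A)).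
Proof.
move=> oA; rewrite openE => y [p [cp Ap] <-].
have n1 : nbhs (c p) (c @` cdom c).
  by apply: open_nbhs_nbhs; split; [exact: cimg_open|exists p].
have n2 : nbhs (c p) (cinv c @^-1` A).
  apply: (@cinv_continuous _ _ _ c (c p)); first by exists p.
  by rewrite cmapK //; exact: open_nbhs_nbhs.
apply: filterS (filterI n1 n2) => z [[q cq <-]] /=; rewrite cmapK // => Aq.
by exists q.
Qed.

Lemma near_chart (T : topologicalType) (c : chart R n T) (A : set T) (p : T) :
  cdom c p -> open A -> A p -> \forall z \near c p, exists2 q, cdom c q /\ A q & z = c q.
Proof.
move=> cp oA Ap.
have : nbhs (c p) (c @` (cdom c `&` A)).
  by apply: open_nbhs_nbhs; split; [exact: chart_image_open|exists p].
by apply: filterS => z [q cAq <-]; exists q.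
Qed.

Implicit Types M N : manifold R n.

Lemma transition_differentiable M (c d : chart R n M) p : atlas c -> atlas d ->
  cdom c p -> cdom d p -> differentiable (d \o cinv c) (c p).
Proof.
move=> ac ad cp dp; apply: (smooth_on_differentiable (atlas_compatible ac ad)).
by exists p.
Qed.

Lemma smooth_map_differentiable M N (U : set M) (F : M -> N) c d p : atlas c -> atlas d ->
  smooth_map U F -> U p -> cdom c p -> cdom d (F p) ->
  differentiable (d \o F \o cinv c) (c p).
Proof.
move=> ac ad [_ sF] Up cp dp; apply: (smooth_on_differentiable (sF c d ac ad)).
by exists p.
Qed.

Lemma of_chartK M (c : chart R n M) p w : atlas c -> cdom c p ->
  to_chart c p (of_chart c p w) = w.
Proof.
move=> ac cp; have ak := chart_at_atlas p; have kp := chart_at_dom p.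
rewrite /of_chart /to_chart.
have E : (chart_at p \o cinv c) (c p) = chart_at p p by rewrite /= cmapK.
rewrite (@diff_comp_near _ _ _ _ _ _ id _ _ _ E); first 1 last.
- exact: transition_differentiable.
- exact: transition_differentiable.
- apply: filterS (near_chart cp (cdom_open (chart_at p)) kp) => z [q [kq cq] ->] /=.
  by rewrite cmapK // cmapK.
by rewrite diff_val.
Qed.

(** Both sides are the differential of [F] read from [c] to the preferred chart at [F p], where
    tangent vectors are represented. *)
Lemma tangent_map_of_chart M N (U : set M) (F : M -> N) c d p w : open U ->
  smooth_map U F -> atlas c -> atlas d -> U p -> cdom c p -> cdom d (F p) ->
  tangent_map F p (of_chart c p w) = of_chart d (F p) ('d (d \o F \o cinv c) (c p) w).
Proof.
move=> oU sF ac ad Up cp dp.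
have ak := chart_at_atlas p; have kp := chart_at_dom p.
have ak' := chart_at_atlas (F p); have kp' := chart_at_dom (F p).
rewrite /tangent_map /of_chart.
have E1 : (chart_at p \o cinv c) (c p) = chart_at p p by rewrite /= cmapK.
have E2 : (d \o F \o cinv c) (c p) = d (F p) by rewrite /= cmapK.
pose h := chart_at (F p) \o F \o cinv c.
apply: (@etrans _ _ ('d h (c p) w)).
  apply: (@diff_comp_near _ _ _ _ _ _ h _ _ _ E1).
  - exact: transition_differentiable.
  - exact: (smooth_map_differentiable ak ak' sF).
  - apply: filterS (near_chart cp (cdom_open (chart_at p)) kp) => z [q [cq kq] ->].
    by rewrite /h /= cmapK // cmapK.
apply/esym; apply: (@diff_comp_near _ _ _ _ _ _ h _ _ _ E2).
- exact: (smooth_map_differentiable ac ad sF).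
- exact: transition_differentiable.
- have oUF : open (U `&` F @^-1` cdom d).
    by apply: open_preimage_on (cdom_open d) => //; case: sF.
  apply: filterS (near_chart cp oUF (conj Up dp)) => z [q [cq [Uq dq]] ->].
  by rewrite /h /= cmapK // cmapK.
Qed.

(** Row convention: the i-th row is the i-th coordinate vector of [c] in the components of
    [chart_at p]. *)
Definition chart_frame M (c : chart R n M) (p : M) : 'M[R]_n :=
  lin1_mx ('d (chart_at p \o cinv c) (c p)).

Lemma of_chartE M (c : chart R n M) p w : of_chart c p w = w *m chart_frame c p.
Proof. by rewrite /chart_frame mul_rV_lin1. Qed.

Lemma chart_frame_unit M (c : chart R n M) p : atlas c -> cdom c p ->
  chart_frame c p \in unitmx.
Proof.
move=> ac cp.
have E : chart_frame c p *m lin1_mx ('d (c \o cinv (chart_at p)) (chart_at p p)) = 1%:M.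
  apply/row_matrixP => i; rewrite row_mul !rowE -of_chartE mul_rV_lin1.
  by rewrite mulmx1; exact: of_chartK.
exact: (mulmx1_unit E).1.
Qed.

Lemma form_row (L g : 'M[R]_n) i j :
  (row i L *m g *m (row j L)^T) 0 0 = (L *m g *m L^T) i j.
Proof.
rewrite -row_mul mxE [RHS]mxE; apply: eq_bigr => k _.
by rewrite [row i _ _ _]mxE [(row j L)^T _ _]mxE [row j L _ _]mxE [L^T _ _]mxE.
Qed.

Lemma form_row_comp (A L g : 'M[R]_n) i j :
  (row i A *m L *m g *m (row j A *m L)^T) 0 0 = (A *m (L *m g *m L^T) *m A^T) i j.
Proof. by rewrite -form_row trmx_mul !mulmxA. Qed.

Lemma metric_coordE M (g : forall p : M, 'M[R]_n) (c : chart R n M) p : cdom c p ->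
  metric_coord g c (c p) = chart_frame c p *m g p *m (chart_frame c p)^T.
Proof.
move=> cp; apply/matrixP => i j; rewrite -form_row mxE cmapK //.
by rewrite !of_chartE !rowE.
Qed.

Lemma minkowski_form_unit : @minkowski_form R n \in unitmx.
Proof.
rewrite /minkowski_form unitmxE det_diag unitfE; apply/prodf_neq0 => i _.
by rewrite mxE; case: ifP; rewrite ?oppr_eq0 oner_eq0.
Qed.

Lemma lorentz_signature_sym (A : 'M[R]_n) : lorentz_signature A -> A^T = A.
Proof.
case=> P _ ->; rewrite !trmx_mul trmxK mulmxA; congr (_ *m _ *m _).
exact: tr_diag_mx.
Qed.

Lemma lorentz_signature_unit (A : 'M[R]_n) : lorentz_signature A -> A \in unitmx.
Proof.
by case=> P uP ->; rewrite !unitmx_mul uP minkowski_form_unit unitmx_tr.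
Qed.

End Charts.

(** * Ricci curvature and conformal maps in coordinates *)

Section SpacetimeCharts.
Context {R : realType} {n : nat}.
Implicit Types M N : spacetime R n.

Definition gcoord M (c : chart R n M) := metric_coord (@metric _ _ M) c.

Lemma gcoord_sym M (c : chart R n M) y : (gcoord c y)^T = gcoord c y.
Proof.
apply/matrixP => i j; rewrite [LHS]mxE [LHS]mxE [RHS]mxE.
set u := of_chart _ _ _; set v := of_chart _ _ _; set g := metric _.
have -> : u *m g *m v^T = (v *m g *m u^T)^T.
  by rewrite !trmx_mul trmxK (lorentz_signature_sym (metric_lorentz _)) mulmxA.
by rewrite mxE.
Qed.

Lemma gcoord_unit M (c : chart R n M) p : atlas c -> cdom c p -> gcoord c (c p) \in unitmx.
Proof.
move=> ac cp; rewrite /gcoord metric_coordE // !unitmx_mul unitmx_tr chart_frame_unit //.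
by rewrite (lorentz_signature_unit (metric_lorentz p)).
Qed.

Lemma christoffelE M (c : chart R n M) k i j :
  christoffel c k i j = fun y => conn (gcoord c) y i k j.
Proof.
apply/funext => y; rewrite [RHS]mxE /christoffel /christoffel_of.
congr (_ * _); apply: eq_bigr => l _; congr (_ * (_ + _ - _)).
- exact: (esym (dmxE i (gcoord c) y j l)).
- exact: (esym (dmxE j (gcoord c) y i l)).
- exact: (esym (dmxE l (gcoord c) y i j)).
Qed.

(** Index conventions agree: [riemann c k l i j] is the entry (k, l) of the curvature matrix in
    directions i and j. *)
Lemma ricciE M (c : chart R n M) l j y :
  ricci c l j y = ricci_trace (conn (gcoord c) y) (dconn (gcoord c) y) l j.
Proof.
apply: eq_bigr => k _; rewrite /riemann /curvature.
have mD (X Y : 'M[R]_n) : (X + Y) k l = X k l + Y k l by rewrite mxE.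
have mN (X : 'M[R]_n) : (- X) k l = - X k l by rewrite mxE.
have mM (X Y : 'M[R]_n) : (X *m Y) k l = \sum_m X k m * Y m l by rewrite mxE.
set A := conn (gcoord c).
rewrite !(mD, mN, mM) (christoffelE c k j l) (christoffelE c k k l) -sumrB.
congr (_ - _ + _).
- exact: (esym (dmxE k (fun z => A z j) y k l)).
- exact: (esym (dmxE j (fun z => A z k) y k l)).
apply: eq_bigr => m _.
by rewrite (christoffelE c k k m) (christoffelE c m j l) (christoffelE c k j m)
  (christoffelE c m k l).
Qed.

(** Conformality evaluated on the coordinate vectors of [c]; this supplies the hypothesis [GE] of
    the Hessian equation. The transpose appears because tangent vectors are rows while the Jacobian
    has the directions as columns. *)
Lemma gcoord_pullback M N (U : set M) (F : M -> N) (c : chart R n M) (d : chart R n N) p e :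
  open U -> smooth_map U F -> atlas c -> atlas d -> U p -> cdom c p -> cdom d (F p) ->
  (forall u v : tangent p,
     gdot p u v = e * gdot (F p) (tangent_map F p u) (tangent_map F p v)) ->
  let h := d \o F \o cinv c in
  gcoord c (c p) = e *: ((jacob h (c p))^T *m gcoord d (h (c p)) *m jacob h (c p)).
Proof.
move=> oU sF ac ad Up cp dp hg h.
have hE : h (c p) = d (F p) by rewrite /h /= cmapK.
have dh : differentiable h (c p) by exact: (smooth_map_differentiable ac ad sF).
rewrite hE /gcoord metric_coordE // [in RHS]metric_coordE //.
apply/matrixP => i j; rewrite -form_row !rowE -!of_chartE.
rewrite -[LHS]/(gdot p (of_chart c p (delta_mx 0 i)) (of_chart c p (delta_mx 0 j))) hg.
rewrite !(tangent_map_of_chart _ oU sF ac ad) // -/h !diff_rowE // [RHS]mxE; congr (_ * _).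
have rJ k : \row_a partial k (fun z => h z 0 a) (c p) = row k (jacob h (c p))^T.
  by apply/rowP => a; rewrite !mxE.
by rewrite !rJ !of_chartE /gdot form_row_comp trmxK.
Qed.

End SpacetimeCharts.

(** * The conformal factor on the manifold *)

Section ConformalRicciFlat.
Context {R : realType} {n : nat}.
Variables (M1 M2 : spacetime R n).

(** [N] is the part of a chart domain lying over the coordinate ball given by
    [conformal_factor_rigidity]. Vanishing of [f] near [q], rather than only at [q], provides the
    vanishing of df. *)
Lemma conformal_factor_locally_rigid (W1 : set M1) (W2 : set M2) (Psi : M1 -> M2)
    (f : M1 -> R) (p : M1) : (3 <= n)%N -> open W1 -> open W2 ->
  smooth_map W1 Psi -> (forall q, W1 q -> W2 (Psi q)) -> smooth_function W1 f ->
  (forall q (u v : tangent q), W1 q -> gdot q u v =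
     expR (2 * f q) * gdot (Psi q) (tangent_map Psi q u) (tangent_map Psi q v)) ->
  ricci_flat W1 -> ricci_flat W2 -> W1 p ->
  exists2 N : set M1, open N /\ N p & N `<=` W1 /\
    forall q x, N q -> N x -> (\forall z \near q, f z = 0) -> f x = 0.
Proof.
move=> n3 oW1 oW2 sPsi Psi12 sf conf ric1 ric2 Wp.
pose c := chart_at p; pose d := chart_at (Psi p).
have ac : atlas c by exact: chart_at_atlas.
have ad : atlas d by exact: chart_at_atlas.
have cp : cdom c p by exact: chart_at_dom.
have dp : cdom d (Psi p) by exact: chart_at_dom.
clearbody c d.
pose h := d \o Psi \o cinv c.
pose D := W1 `&` Psi @^-1` cdom d.
have oD : open D by apply: open_preimage_on (cdom_open d) => //; case: sPsi.
pose U := c @` (cdom c `&` D); pose U' := d @` (cdom d `&` W2).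
have oU : open U by exact: chart_image_open.
have oU' : open U' by exact: chart_image_open.
have sh : smooth_on U h.
  have := sPsi.2 c d ac ad; rewrite -setIA; exact.
have UW : U `<=` c @` (cdom c `&` W1) by move=> _ [q [cq [Wq _]] <-]; exists q.
have Uc : U `<=` c @` cdom c by move=> _ [q [cq _] <-]; exists q.
have Uc' : U' `<=` d @` cdom d by move=> _ [q [cq _] <-]; exists q.
have Up : U (c p) by exists p.
have [r r0 [BU rig]] : exists2 r : R, 0 < r & ball (c p) r `<=` U /\
    forall z x, ball (c p) r z -> ball (c p) r x -> (f \o cinv c) z = 0 ->
    (forall j, partial j (f \o cinv c) z = 0) -> (f \o cinv c) x = 0.
  apply: (@conformal_factor_rigidity R n U U' (gcoord c) (gcoord d) (f \o cinv c) h (c p)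
    oU oU') => //.
  - by move=> _ [q [cq [Wq dq]] <-]; exists (Psi q); [split=> //; exact: Psi12|rewrite /h /= cmapK].
  - by move=> i j; apply: (smooth_on_subset Uc); exact: metric_smooth.
  - by move=> i j; apply: (smooth_on_subset Uc'); exact: metric_smooth.
  - by apply: (smooth_on_subset UW); exact: sf.
  - by move=> a; exact: smooth_on_coord.
  - by move=> z Uz; exact: smooth_on_differentiable sh Uz.
  - by move=> z; exact: gcoord_sym.
  - by move=> z; exact: gcoord_sym.
  - by move=> _ [q [cq _] <-]; exact: gcoord_unit.
  - by move=> _ [q [cq _] <-]; exact: gcoord_unit.
  - move=> _ [q [cq [Wq dq]] <-].
    have -> : (f \o cinv c) (c q) = f q by rewrite /= cmapK.
    apply: (gcoord_pullback oW1 sPsi ac ad Wq cq dq) => u v.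
    exact: conf.
  - by move=> _ [q [cq [Wq dq]] <-] l j; rewrite -ricciE; exact: ric1.
  - by move=> _ [q [cq Wq] <-] l j; rewrite -ricciE; exact: ric2.
pose N := cdom c `&` c @^-1` (ball (c p) r).
have oN : open N.
  apply: open_preimage_on; [exact: cdom_open|exact: cmap_continuous|exact: ball_open].
exists N; first by split=> //; split=> //; exact: ballxx.
split.
  move=> x [cx /BU[q [cq [Wq _]] E]].
  by rewrite -(cmapK cx) -E cmapK.
move=> q x [cq Bq] [cx Bx] fq.
rewrite -(cmapK cx); apply: (rig (c q) (c x)) => //.
  by rewrite /= cmapK //; exact: nbhs_singleton fq.
move=> j; rewrite -(partial_cst j 0 (c q)); apply: partial_near.
have : nbhs (cinv c (c q)) [set z | f z = 0] by rewrite cmapK.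
by apply: cinv_continuous; exists q.
Qed.

Lemma tangent_map_near (U : set M1) (F G : M1 -> M2) (p : M1) (u v : tangent p) :
  smooth_map U F -> U p -> {near p, F =1 G} ->
  gdot (F p) (tangent_map F p u) (tangent_map F p v) =
  gdot (G p) (tangent_map G p u) (tangent_map G p v).
Proof.
move=> sF Up FG; rewrite /gdot /tangent_map.
have kp := chart_at_dom p.
have dF : differentiable (chart_at (F p) \o F \o cinv (chart_at p)) (chart_at p p).
  by apply: (smooth_map_differentiable _ _ sF) => //;
    [exact: chart_at_atlas|exact: chart_at_atlas|exact: chart_at_dom].
have E : F p = G p by exact: nbhs_singleton FG.
have FGk : {near chart_at p p, chart_at (F p) \o F \o cinv (chart_at p) =1
    chart_at (F p) \o G \o cinv (chart_at p)}.
  have : nbhs (chart_at p p) (cinv (chart_at p) @^-1` [set z | F z = G z]).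
    apply: (@cinv_continuous _ _ _ (chart_at p) (chart_at p p)); first by exists p.
    by rewrite cmapK.
  by apply: filterS => z /= ->.
have [_ dE] := near_eq_differential FGk dF.
(* Both the metric and the preferred chart depend on the base point; with the point as an argument
   of a scalar function, [F p = G p] is transported by congruence. *)
pose K (q : M2) (L : 'rV[R]_n -> 'rV[R]_n) : R := (L u *m metric q *m (L v)^T) 0 0.
apply: etrans (congr1 (K (F p)) (esym dE)) _.
exact: (congr1 (fun q => K q ('d (chart_at q \o G \o cinv (chart_at p)) (chart_at p p))) E).
Qed.

Lemma conformal_factor_on_overlap (V1 W1 : set M1) (V2 : set M2) (Phi Psi : M1 -> M2)
    (f : M1 -> R) (p : M1) : open V1 -> open W1 ->
  smooth_map W1 Psi -> lorentz_isometry V1 V2 Phi ->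
  (forall q, W1 q -> V1 q -> Psi q = Phi q) ->
  (forall q (u v : tangent q), W1 q -> gdot q u v =
     expR (2 * f q) * gdot (Psi q) (tangent_map Psi q u) (tangent_map Psi q v)) ->
  V1 p -> W1 p -> f p = 0.
Proof.
move=> oV oW sPsi [_ iso] PP conf Vp Wp.
have near_eq : {near p, Psi =1 Phi}.
  have nW : nbhs p W1 by exact: open_nbhs_nbhs.
  have nV : nbhs p V1 by exact: open_nbhs_nbhs.
  by apply: filterS (filterI nW nV) => z [Wz Vz]; exact: PP.
(* A time-like vector has nonzero square, so g(u, u) can be cancelled from g(u, u) = e^{2f} g(u,
   u). *)
pose u := torient p.
have gu : gdot p u u < 0 by exact: torient_timelike.
have E1 := iso p u u Vp; have E2 := conf p u u Wp.
rewrite (tangent_map_near u u sPsi Wp near_eq) -E1 in E2.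
have : expR (2 * f p) = expR 0.
  rewrite expR0; apply: (@mulIf _ (gdot p u u)); first by rewrite ltr0_neq0.
  by rewrite mul1r -E2.
by move/expR_inj/eqP; rewrite mulf_eq0 pnatr_eq0 => /eqP.
Qed.

End ConformalRicciFlat.

Theorem corollary1p3 (R : realType) (n : nat) (hn : (3 <= n)%N)
  (M1 M2 : spacetime R n)
  (hopen1 : open_manifold M1) (hopen2 : open_manifold M2)
  (hgh1 : globally_hyperbolic M1) (hgh2 : globally_hyperbolic M2)
  (mu1 : R -> M1) (mu2 : R -> M2)
  (hmu1 : timelike_path (-1) 1 mu1) (hmu1f : future_path (-1) 1 mu1)
  (hmu2 : timelike_path (-1) 1 mu2) (hmu2f : future_path (-1) 1 mu2)
  (sm sp : R) (hsm : -1 < sm) (hs : sm < sp) (hsp : sp < 1)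
  (V1 : set M1) (V2 : set M2)
  (hV1 : open V1) (hV2 : open V2) (hV1c : connected V1) (hV2c : connected V2)
  (hmuV1 : forall s : R, -1 <= s <= 1 -> V1 (mu1 s))
  (hmuV2 : forall s : R, -1 <= s <= 1 -> V2 (mu2 s))
  (W1 : set M1) (W2 : set M2)
  (hW1 : open W1) (hW2 : open W2)
  (hW1c : compact (closure W1)) (hW2c : compact (closure W2))
  (hW1J : closure W1 `<=` Jpast (mu1 sp) `\` Ipast (mu1 sm))
  (hW2J : closure W2 `<=` Jpast (mu2 sp) `\` Ipast (mu2 sm))
  (Phi : M1 -> M2)
  (hPhi : conformal_diffeo V1 V2 Phi)
  (hPhimu : forall s : R, -1 <= s <= 1 -> Phi (mu1 s) = mu2 s)
  (hPhiE : [set Phi @` S | S in earliest_obs_family V1 W1]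
           = earliest_obs_family V2 W2)
  (Psi : M1 -> M2)
  (hPsi : conformal_diffeo W1 W2 Psi)
  (hPsiPhi : forall x, W1 x -> V1 x -> Psi x = Phi x)
  (hric1 : ricci_flat W1) (hric2 : ricci_flat W2)
  (hPhiiso : lorentz_isometry V1 V2 Phi)
  (hcomp1 : forall x, W1 x -> connected_component W1 x `&` V1 !=set0)
  (hcomp2 : forall x, W2 x -> connected_component W2 x `&` V2 !=set0) :
  lorentz_isometry W1 W2 Psi.
Proof.
have [diffPsi [f sf conf]] := hPsi.
split; first exact: diffPsi.
have sPsi : smooth_map W1 Psi by case: diffPsi.
have Psi12 q : W1 q -> W2 (Psi q) by case: diffPsi => _ [G [_ /(_ q) H _]] /H[].
have f0 q : V1 q -> W1 q -> f q = 0.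
  exact: (conformal_factor_on_overlap hV1 hW1 sPsi hPhiiso hPsiPhi conf).
(* The interior is used because propagation needs f and df to vanish together. *)
pose Z := interior [set z | f z = 0].
have ZE q : Z q -> f q = 0 by exact: nbhs_singleton.
suff W1Z : W1 `<=` Z.
  by move=> p u v Wp; rewrite conf // ZE ?mulr0 ?expR0 ?mul1r //; exact: W1Z.
move=> x Wx; pose C := connected_component W1 x.
have CW : C `<=` W1 by exact: connected_component_sub.
have Cx : C x by exact: connected_component_refl.
suff CZ : C `&` Z = C by have [_] : (C `&` Z) x by rewrite CZ.
(* A nonempty relatively open and closed subset of a connected component is the whole component. *)
apply: (@component_connected _ W1 x).
- have [q [Cq Vq]] := hcomp1 x Wx; have Wq := CW q Cq; exists q; split=> //.
  have nW : nbhs q W1 by exact: open_nbhs_nbhs.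
  have nV : nbhs q V1 by exact: open_nbhs_nbhs.
  by apply: filterS (filterI nW nV) => z [Wz Vz]; exact: f0.
- by exists Z => //; exact: open_interior.
(* If [q] in C is a limit of Z, its rigid neighbourhood [N] meets Z, so f vanishes on all of [N] and
   [q] lies in Z. *)
- exists (closure Z); first exact: closed_closure.
  apply/seteqP; split=> q [Cq Zq]; split=> //; first exact: subset_closure.
  have [N [oN Nq] [NW rig]] :=
    conformal_factor_locally_rigid hn hW1 hW2 sPsi Psi12 sf conf hric1 hric2 (CW q Cq).
  have nN : nbhs q N by exact: open_nbhs_nbhs.
  have [z [Zz Nz]] := Zq N nN.
  by apply: filterS nN => y Ny; exact: rig Nz Ny Zz.
Qed.
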